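(* Consider the precoded OFDM system described in the context, with the time-frequency precoders $\mathbf{w}_l=\mathbf{w}_l(\tau_{\rm tr})$ used on all subcarriers $l\in\{0,\dots,N_{\rm sc}-1\}$. Let $\mathrm{SINR}_i^{\infty}(\tau_{\rm tr})$ be the quantity given in the context, to which $\mathrm{SINR}_i$ tends as $N_{\rm t}\to\infty$ with $\mathrm{SNR}_{\rm op}=N_{\rm t}\,\mathrm{SNR}>0$ fixed. If $\tau_{\rm tr}\le N_{\rm cp}+1$, then $$\mathrm{SINR}_i^{\infty}(\tau_{\rm tr})=\alpha_{\tau_{\rm tr}}^2\,\mathrm{SNR}_{\rm op},\qquad \alpha_{\tau_{\rm tr}}^2=\sum_{p=0}^{\tau_{\rm tr}-1}E_p,$$ i.e., the inter-symbol interference (ISI) and the inter-carrier interference (ICI) vanish as $N_{\rm t}\to\infty$.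
   Context: **Parameters.** $N_{\rm fft}$ (FFT size), $N_{\rm sc}\le N_{\rm fft}$ (number of occupied subcarriers), $N_{\rm cp}\ge0$ (cyclic prefix length), $L\ge1$ (number of channel taps, with $L\le N_{\rm fft}$), $1\le\tau_{\rm tr}\le L$ (truncation threshold) and $N_{\rm t}$ (number of transmit antennas) are integers; $\mathrm{j}=\sqrt{-1}$. Superscripts $*$ and $\mathrm T$ denote complex conjugate and transpose; $\delta_{l,i}$ is the Kronecker delta. **Channel.** For $p=0,\dots,L-1$ the tap vector $\mathbf{h}_p=\mathbf{h}[p]\in\mathbb{C}^{N_{\rm t}}$ has i.i.d. zero-mean complex normal entries of variance $E_p$, and the taps are independent. It is assumed that $\alpha_{\tau_{\rm tr}}^2=\sum_{p=0}^{\tau_{\rm tr}-1}E_p>0$. **Weight functions.** $$c[m]=\begin{cases}\frac{N_{\rm fft}+m}{N_{\rm fft}}& -N_{\rm fft}\le m\le0\\ 1&0\le m\le N_{\rm cp}\\ \frac{N_{\rm fft}-(m-N_{\rm cp})}{N_{\rm fft}}& N_{\rm cp}\le m\le N_{\rm fft}+N_{\rm cp}\\ 0&\text{otherwise,}\end{cases}$$ for $l\ne i$, $$\tilde c_{l,i}[m]=\begin{cases}\dfrac{1-e^{\mathrm{j}2\pi m(l-i)/N_{\rm fft}}}{N_{\rm fft}\left(1-e^{\mathrm{j}2\pi(l-i)/N_{\rm fft}}\right)}& -N_{\rm fft}\le m\le0\\[2mm] \dfrac{e^{\mathrm{j}2\pi(m-N_{\rm cp})(l-i)/N_{\rm fft}}-1}{N_{\rm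 fft}\left(1-e^{\mathrm{j}2\pi(l-i)/N_{\rm fft}}\right)}& N_{\rm cp}\le m\le N_{\rm fft}+N_{\rm cp}\\ 0&\text{otherwise,}\end{cases}$$ and $\tilde c_{i,i}[m]=(1-c[m])/\sqrt2$. **OFDM channels.** For subcarriers $i,l\in\{0,\dots,N_{\rm sc}-1\}$, $$\hat{\mathbf{h}}_i=\sum_{p=0}^{L-1}\mathbf{h}_pe^{-\mathrm{j}2\pi ip/N_{\rm fft}},\qquad \hat{\mathbf{h}}_{0,i,i}=\sum_{m=0}^{L-1}c[m]\mathbf{h}[m]e^{-\mathrm{j}2\pi im/N_{\rm fft}},$$ $$\hat{\mathbf{h}}_{0,l,i}=\sum_{m=N_{\rm cp}}^{L-1}\tilde c_{l,i}[m]\mathbf{h}[m]e^{-\mathrm{j}2\pi lm/N_{\rm fft}}\quad(l\ne i),\qquad \hat{\mathbf{h}}_{-1,l,i}=e^{\mathrm{j}2\pi lN_{\rm cp}/N_{\rm fft}}\left(\delta_{l,i}\hat{\mathbf{h}}_i-\hat{\mathbf{h}}_{0,l,i}\right).$$ **Time-frequency precoder.** $\mathbf{w}_l(\tau_{\rm tr})=\hat{\mathbf{h}}_l^{*}(\tau_{\rm tr})/\|\hat{\mathbf{h}}_l(\tau_{\rm tr})\|$ with $\hat{\mathbf{h}}_l(\tau_{\rm tr})=\sum_{p=0}^{\tau_{\rm tr}-1}\mathbf{h}_pe^{-\mathrm{j}2\pi lp/N_{\rm fft}}$. **Demodulated symbol.** With data symbols $x_{b,l}$ (block $b$, subcarrier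 $l$) i.i.d. zero-mean complex normal of average power $P$ and noise $n_i$ of variance $\sigma_n^2$, the demodulated symbol on subcarrier $i$ of block $0$ is $$y_i=\hat{\mathbf{h}}_{0,i,i}^{\mathrm T}\mathbf{w}_ix_{0,i}+\underbrace{\sum_{l\ne i}\hat{\mathbf{h}}_{0,l,i}^{\mathrm T}\mathbf{w}_lx_{0,l}}_{\text{ICI}}+\underbrace{\sum_{l=0}^{N_{\rm sc}-1}\hat{\mathbf{h}}_{-1,l,i}^{\mathrm T}\mathbf{w}_lx_{-1,l}}_{\text{ISI}}+n_i .$$ **SINR.** With $\mathrm{SNR}=P/\sigma_n^2$, the SINR on subcarrier $i$ is $$\mathrm{SINR}_i=\frac{|\hat{\mathbf{h}}_{0,i,i}^{\mathrm T}\mathbf{w}_i|^2}{|\mathbf{w}_i^{\mathrm T}(\hat{\mathbf{h}}_i-\hat{\mathbf{h}}_{0,i,i})|^2+\sum_{l=0,\,l\ne i}^{N_{\rm sc}-1}2|\hat{\mathbf{h}}_{0,l,i}^{\mathrm T}\mathbf{w}_l|^2+1/\mathrm{SNR}} .$$ As $N_{\rm t}\to\infty$ with $\mathrm{SNR}_{\rm op}=N_{\rm t}\mathrm{SNR}>0$ fixed, it tends to $$\mathrm{SINR}_i^{\infty}(\tau_{\rm tr})=\frac{\left(\sum_{p=0}^{\tau_{\rm tr}-1}c[p]E_p\right)^2}{\sum_{l=0}^{N_{\rm sc}-1}2\left|\sum_{p=N_{\rm cp}+1}^{\tau_{\rm tr}-1}\tilde c_{l,i}[p]E_p\right|^2+\alpha_{\tau_{\rm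 tr}}^2\,\mathrm{SNR}_{\rm op}^{-1}}$$ (empty sums are $0$). *)

(* Defs.v *)
(* MathComp / MathComp-Analysis, over an arbitrary R : realType, with complex
   numbers R[i] from mathcomp-real-closed. *)
From HB Require Import structures.
From mathcomp Require Export all_boot all_order all_algebra.
From mathcomp Require Export all_classical all_reals all_analysis.
From mathcomp Require Export complex.

Set Implicit Arguments.
Unset Strict Implicit.
Unset Printing Implicit Defensive.

Import Order.TTheory GRing.Theory Num.Theory.
Import numFieldNormedType.Exports.

Local Open Scope classical_set_scope.
Local Open Scope ring_scope.
Local Open Scope complex_scope.

Local Notation normc := ComplexField.Normc.normc.

Section Probability.
Context {d : measure_display} {T : measurableType d} {R : realType}.
Variable P : probability T R.

Definition measurable_cplx (X : T -> R[i]) : Prop :=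
  measurable_fun setT (fun w => complex.Re (X w)) /\
  measurable_fun setT (fun w => complex.Im (X w)).

(* [normal_prob 0 0] is by convention the uniform law on [0, 1], not the
   degenerate normal law, hence the case distinction. *)
Definition normal0_law (v : R) (A : set R) : \bar R :=
  if v == 0 then \d_(0 : R) A else normal_prob 0 (Num.sqrt v) A.

(* Circularly-symmetric complex normal CN(0, v): independent real and imaginary
   parts, each N(0, v / 2), so that E|X|^2 = v. *)
Definition complex_normal0 (v : R) (X : T -> R[i]) : Prop :=
  measurable_cplx X /\
  forall A B : set R, measurable A -> measurable B ->
    P [set w | A (complex.Re (X w)) /\ B (complex.Im (X w))] =
    (normal0_law (v / 2) A * normal0_law (v / 2) B)%E.

(* Mutual independence: product rule for every finite subfamily. The Borel sets
   of R[i] are those of R * R under z |-> (Re z, Im z). *)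
Definition mutually_independent (I : eqType) (X : I -> T -> R[i]) : Prop :=
  forall (s : seq I) (B : I -> set (R * R)),
    uniq s -> (forall k, measurable (B k)) ->
    let event k := [set w | B k (complex.Re (X k w), complex.Im (X k w))] in
    P (\bigcap_(k in [set` s]) event k) = (\prod_(k <- s) P (event k))%E.

End Probability.

Section OFDM.
Variables (R : realType) (Nfft Nsc Ncp L : nat).

Local Notation C := R[i].

Definition jexp (k : int) : C :=
  let t := 2 * pi * k%:~R / Nfft%:R in cos t +i* sin t.

Definition cwt (m : int) : R :=
  if (- Nfft%:Z <= m <= 0) then (Nfft%:R + m%:~R) / Nfft%:R
  else if (0 <= m <= Ncp%:Z) then 1
  else if (Ncp%:Z <= m <= Nfft%:Z + Ncp%:Z) then
    (Nfft%:R - (m - Ncp%:Z)%:~R) / Nfft%:R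
  else 0.

Definition ctilde (l i : nat) (m : int) : C :=
  if l == i then ((1 - cwt m) / Num.sqrt 2)%:C
  else
    let e := l%:Z - i%:Z in
    if (- Nfft%:Z <= m <= 0) then
      (1 - jexp (m * e)) / (Nfft%:R * (1 - jexp e))
    else if (Ncp%:Z <= m <= Nfft%:Z + Ncp%:Z) then
      (jexp ((m - Ncp%:Z) * e) - 1) / (Nfft%:R * (1 - jexp e))
    else 0.

Definition dotT (n : nat) (u v : 'cV[C]_n) : C := (u^T *m v) 0 0.

Definition vnorm (n : nat) (u : 'cV[C]_n) : R :=
  Num.sqrt (\sum_(k < n) normc (u k 0) ^+ 2).

Section Realization.
Variables (Nt : nat) (h : 'I_L -> 'cV[C]_Nt) (tau : nat).

Definition hhat (i : nat) : 'cV[C]_Nt :=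
  \sum_(p < L) jexp (- (i * p)%N%:Z) *: h p.

Definition hhat_tr (l : nat) : 'cV[C]_Nt :=
  \sum_(p < L | (p < tau)%N) jexp (- (l * p)%N%:Z) *: h p.

Definition hhat0 (l i : nat) : 'cV[C]_Nt :=
  if l == i then
    \sum_(m < L) ((cwt m%:Z)%:C * jexp (- (i * m)%N%:Z)) *: h m
  else
    \sum_(m < L | (Ncp <= m)%N)
      (ctilde l i m%:Z * jexp (- (l * m)%N%:Z)) *: h m.

Definition hhatm1 (l i : nat) : 'cV[C]_Nt :=
  jexp (l * Ncp)%N%:Z *: ((l == i)%:R *: hhat i - hhat0 l i).

Definition precoder (l : nat) : 'cV[C]_Nt :=
  ((vnorm (hhat_tr l))^-1)%:C *: map_mx conjc (hhat_tr l).

(* [x b l] is the symbol sent in block [b] on subcarrier [l]. *)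
Definition ici (x : int -> 'I_Nsc -> C) (i : 'I_Nsc) : C :=
  \sum_(l < Nsc | l != i) dotT (hhat0 l i) (precoder l) * x 0 l.

Definition isi (x : int -> 'I_Nsc -> C) (i : 'I_Nsc) : C :=
  \sum_(l < Nsc) dotT (hhatm1 l i) (precoder l) * x (- 1) l.

Definition sinr (snr : R) (i : 'I_Nsc) : R :=
  normc (dotT (hhat0 i i) (precoder i)) ^+ 2 /
  (normc (dotT (precoder i) (hhat i - hhat0 i i)) ^+ 2 +
   \sum_(l < Nsc | l != i) 2 * normc (dotT (hhat0 l i) (precoder l)) ^+ 2 +
   1 / snr).

End Realization.

Definition alpha2 (E : 'I_L -> R) (tau : nat) : R :=
  \sum_(p < L | (p < tau)%N) E p.

Definition sinr_inf (E : 'I_L -> R) (tau : nat) (snr_op : R) (i : 'I_Nsc) : R :=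
  (\sum_(p < L | (p < tau)%N) cwt p%:Z * E p) ^+ 2 /
  (\sum_(l < Nsc)
     2 * normc (\sum_(p < L | (Ncp < p < tau)%N) ctilde l i p%:Z * (E p)%:C) ^+ 2
   + alpha2 E tau * snr_op^-1).

End OFDM.

(* The antennas are indexed by nat, and an array of [n] antennas uses the first
   [n] of them: this puts the channels of all array sizes on one sample space. *)
Definition channel (R : realType) (T : Type) (L : nat)
    (h : 'I_L -> nat -> T -> R[i]) (w : T) (n : nat) (p : 'I_L) : 'cV[R[i]]_n :=
  \col_(k < n) h p k w.

(* Mean power over the symbols [x], the channel being held fixed. *)
Definition mean_power (d : measure_display) (S : measurableType d)
    (R : realType) (Q : probability S R) (Z : S -> R[i]) : \bar R :=
  'E_Q[fun s => normc (Z s) ^+ 2].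

(* Main.v *)
(* The empirical Gram matrix (1/n) sum_k h_(p,k) h_(q,k)^* of the taps converges
   almost surely to diag(E_p). Its entries are averages of pairwise orthogonal
   variables with bounded second moments, so this follows from a strong law
   proved by Chebyshev-type summability along the squares n = m^2 together with
   the oscillation between consecutive squares. By bilinearity, for
   u = sum_p c_p h_p, |u^T w_l|^2 / n tends to
   |sum_(p < tau) c_p e^(j 2 pi l p / N_fft) E_p|^2 / alpha^2: only the taps below tau
   survive. Since tau <= N_cp + 1, on these taps the weight c[p] is 1 and the
   cross weights vanish, so after division by n every interference gain tends to
   0 and the signal gain tends to alpha^2. As the transmit power is O(1/n), the
   mean ICI and ISI powers, bounded by a multiple of sum_l |gain_l|^2 / n, tend
   to 0 as well. *)
Require Import Defs.
From HB Require Import structures.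
From mathcomp Require Import measurable_realfun ring lra zify.

Set Implicit Arguments.
Unset Strict Implicit.
Unset Printing Implicit Defensive.

Import Order.TTheory GRing.Theory Num.Theory.
Import numFieldNormedType.Exports.

Local Open Scope classical_set_scope.
Local Open Scope ring_scope.

(** * Integration against a density, from indicators to nonnegative functions *)

Section density.
Context {d d' : measure_display} {X : measurableType d} {U : measurableType d'}
  {R : realType}.
Variables (mu : {measure set X -> \bar R}) (nu : {measure set U -> \bar R}).
Variables (xi : X -> U) (G : X -> R) (c : R).
Hypotheses (mxi : measurable_fun setT xi) (mG : measurable_fun setT G).
Hypotheses (G0 : forall x, 0 <= G x) (c0 : 0 <= c).
Hypothesis muG : forall A, measurable A ->
  (\int[mu]_x (\1_A (xi x) * G x)%:E = c%:E * nu A)%E.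

Import HBNNSimple.

Let density_nnsfun (g : {nnsfun U >-> R}) :
  (\int[mu]_x (g (xi x) * G x)%:E = c%:E * \int[nu]_y (g y)%:E)%E.
Proof.
rewrite integralT_nnsfun sintegralE ge0_mule_fsumr; last first.
  by move=> r; exact: nnsfun_mulemu_ge0.
transitivity (\int[mu]_x (\sum_(k \in range g)
    (k * (\1_(g @^-1` [set k]) (xi x) * G x))%:E))%E.
  apply: eq_integral => x _; rewrite fimfunE fsbig_finite//= big_distrl/=.
  by rewrite -sumEFin fsbig_finite//=; apply: eq_bigr => k _; rewrite mulrA.
rewrite ge0_integral_fsum//=; last 2 first.
- move=> k; apply/measurable_EFinP; apply: measurable_funM => //.
  apply: measurable_funM => //; apply: measurableT_comp => //.
(* Here [k] is any real: where the indicator is nonzero, [k] is a value of [g], hence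
   nonnegative. *)
- move=> k x _; rewrite lee_fin mulrA mulr_ge0// indicE.
  case: (boolP (xi x \in _)) => [/set_mem/= <-|_] /=.
    by rewrite mulr1; exact: fun_ge0.
  by rewrite mulr0.
apply: eq_fsbigr => k; rewrite inE => -[y _ <-].
under eq_integral do rewrite EFinM.
rewrite ge0_integralZl_EFin//=.
- by rewrite muG// muleCA.
- by move=> x _; rewrite lee_fin mulr_ge0.
- apply/measurable_EFinP; apply: measurable_funM => //.
  by apply: measurableT_comp => //.
Qed.

(** Linearity gives the identity for simple functions, and monotone convergence along
    [nnsfun_approx] extends it. The map [xi] and the constant [c] stay general so that it serves
    both for laws with a density and for replacing one independent factor. *)
Lemma ge0_integral_density (f : U -> R) :
  measurable_fun setT f -> (forall y, 0 <= f y) ->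
  (\int[mu]_x (f (xi x) * G x)%:E = c%:E * \int[nu]_y (f y)%:E)%E.
Proof.
move=> mf f0.
have mEf : measurable_fun setT (EFin \o f) by exact/measurable_EFinP.
pose f_ := nnsfun_approx measurableT mEf.
have cvf y : EFin \o f_ ^~ y @ \oo --> (EFin \o f) y.
  by apply: cvg_nnsfun_approx => //= z _; rewrite lee_fin.
have cvfR y : f_ ^~ y @ \oo --> f y.
  by have /fine_cvgP[_] := cvf y.
have mf_ n : measurable_fun setT (fun x => f_ n (xi x)).
  by apply: (measurableT_comp (f := f_ n)).
apply: (@cvg_unique _ (@ereal_hausdorff R)
  (\int[mu]_x (f_ n (xi x) * G x)%:E @[n --> \oo])%E).
- have := @cvg_monotone_convergence _ _ _ mu setT measurableT
    (fun n x => (f_ n (xi x) * G x)%:E).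
  have -> : (fun x => limn (fun n => (f_ n (xi x) * G x)%:E)) =
            fun x => (f (xi x) * G x)%:E.
    apply/funext => x; apply/cvg_lim => //.
    apply: cvg_EFin; first exact: nearW.
    by apply: cvgMl; exact: cvfR.
  apply.
  + by move=> n; apply/measurable_EFinP/measurable_funM.
  + by move=> n x _; rewrite lee_fin mulr_ge0.
  + move=> x _ m n mn; rewrite lee_fin ler_wpM2r//.
    exact/lefP/nd_nnsfun_approx.
- have -> : (fun n => \int[mu]_x (f_ n (xi x) * G x)%:E)%E =
            (fun n => c%:E * \int[nu]_y (f_ n y)%:E)%E.
    by apply/funext => n; exact: density_nnsfun.
  apply: cvgeZl => //.
  have := @cvg_monotone_convergence _ _ _ nu setT measurableT
    (fun n x => (f_ n x)%:E).
  have -> : (fun x => limn (fun n => (f_ n x)%:E)) = fun x => (f x)%:E.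
    by apply/funext => x; apply/cvg_lim => //; exact: cvf.
  apply.
  + by move=> n; exact/measurable_EFinP.
  + by move=> n x _; rewrite lee_fin.
  + by move=> x _ m n mn; rewrite lee_fin; exact/lefP/nd_nnsfun_approx.
Qed.

End density.

(** * Expectation of a product of independent factors *)

Section independence.
Context {d d' : measure_display} {T : measurableType d} {U : measurableType d'}
  {R : realType} (P : probability T R) {I : eqType} (xi : I -> T -> U).
Hypothesis mxi : forall k, measurable_fun setT (xi k).
Hypothesis indep : forall (s : seq I) (A : I -> set U),
  uniq s -> (forall k, measurable (A k)) ->
  P (\bigcap_(k in [set` s]) (xi k @^-1` A k)) =
  (\prod_(k <- s) P (xi k @^-1` A k))%E.

Let integrable_comp (f : U -> R) k :=
  P.-integrable setT (fun x => (f (xi k x))%:E).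

Let mpreim k A : measurable A -> measurable (xi k @^-1` A).
Proof. by move=> mA; rewrite -[_ @^-1` _]setTI; exact: mxi. Qed.

Let prod_indic (s : seq I) (A : I -> set U) x :
  \prod_(k <- s) \1_(A k) (xi k x) =
  \1_(\bigcap_(k in [set` s]) (xi k @^-1` A k)) x :> R.
Proof.
elim: s => [|k s ih].
  by rewrite big_nil set_nil bigcap_set0 indicT.
rewrite big_cons ih !indicE -natrM mulnb; congr (_%:R); congr nat_of_bool.
apply/andP/idP => [[/set_mem xk /set_mem xs]|/set_mem xs].
  by apply/mem_set => j /=; rewrite inE => /predU1P[->//|js]; exact: xs.
split; apply/mem_set; first by apply: xs => /=; rewrite mem_head.
by move=> j /= js; apply: xs => /=; rewrite inE js orbT.
Qed.

(* The events of [s2] are replaced one at a time by functions moved to [s1]: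
   for fixed other factors, both sides are measures in the event of [k], hence
   [ge0_integral_density] extends their equality to nonnegative functions. *)
Lemma ge0_expectation_prod_indic (f : I -> U -> R) (A : I -> set U)
    (s1 s2 : seq I) : uniq (s1 ++ s2) ->
  (forall k, measurable_fun setT (f k)) -> (forall k y, 0 <= f k y) ->
  (forall k, integrable_comp (f k) k) -> (forall k, measurable (A k)) ->
  (\int[P]_x (\prod_(k <- s1) f k (xi k x) *
              \prod_(k <- s2) \1_(A k) (xi k x))%:E =
   (\prod_(k <- s1) (\int[P]_x f k (xi k x))%R *
    \prod_(k <- s2) fine (P (xi k @^-1` A k)))%:E)%E.
Proof.
move=> us mf f0 intf mA; elim: s1 => [|k s1 ih] in s2 A us mA *.
  rewrite big_nil mul1r.
  under eq_integral do rewrite big_nil mul1r prod_indic.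
  rewrite integral_indic//; last first.
    by apply: fin_bigcap_measurable => [|k _]; [exact: finite_seq|exact: mpreim].
  rewrite setIT; etransitivity; first by apply: indep => //.
  rewrite -prodEFin; apply: eq_bigr => k _.
  by rewrite fineK// fin_num_measure//; exact: mpreim.
have /= /andP[] := us; rewrite mem_cat negb_or => /andP[ks1 ks2] us12.
pose G x := \prod_(j <- s1) f j (xi j x) * \prod_(j <- s2) \1_(A j) (xi j x).
under eq_integral do rewrite big_cons -mulrA -/(G _).
pose c := \prod_(j <- s1) (\int[P]_x f j (xi j x)) *
          \prod_(j <- s2) fine (P (xi j @^-1` A j)).
rewrite big_cons.
have mG : measurable_fun setT G.
  apply: measurable_funM.
    by apply: measurable_prod => j _; exact: measurableT_comp.
  apply: measurable_prod => j _; apply: measurableT_comp => //.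
have G0 x : 0 <= G x by apply: mulr_ge0; apply: prodr_ge0.
have c0 : 0 <= c.
  apply: mulr_ge0; apply: prodr_ge0 => j _; last exact: fine_ge0.
  by apply: Rintegral_ge0.
pose X : {mfun T >-> U} :=
  HB.pack (xi k) (isMeasurableFun.Build _ _ _ _ _ (mxi k)).
etransitivity.
  apply: (@ge0_integral_density _ _ _ _ _ P (pushforward P X) (xi k) G c) => //.
  move=> B mB.
  (* The factor of [k] moves to the indicator side with event [B]; as [k] is not in [s2], the other
     events are unchanged and the induction hypothesis applies. *)
  pose A' j := if j == k then B else A j.
  have eqA' (g : I -> set U -> R) :
      \prod_(j <- s2) g j (A' j) = \prod_(j <- s2) g j (A j).
    rewrite big_seq [RHS]big_seq; apply: eq_bigr => j js2.
    by rewrite /A'; case: eqP => // jk; rewrite jk (negbTE ks2) in js2.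
  have A'k : A' k = B by rewrite /A' eqxx.
  transitivity (\int[P]_x (\prod_(j <- s1) f j (xi j x) *
      \prod_(j <- k :: s2) \1_(A' j) (xi j x))%:E)%E.
    apply: eq_integral => x _.
    by rewrite big_cons A'k (eqA' (fun j B => \1_B (xi j x))) mulrCA.
  rewrite ih.
  + rewrite big_cons A'k (eqA' (fun j B => fine (P (xi j @^-1` B)))).
    rewrite mulrCA -/c mulrC EFinM fineK//.
    by rewrite fin_num_measure//; exact: mpreim.
  + by rewrite -cat1s uniq_catCA cat1s.
  + by move=> j; rewrite /A'; case: ifP.
rewrite ge0_integral_pushforward//=.
- rewrite preimage_setT -mulrA [in RHS]mulrC -/c [in RHS]EFinM.
  congr (_ * _)%E.
  by rewrite /Rintegral fineK//; exact: integrable_fin_num (intf k).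
- exact/measurable_EFinP.
- by move=> y _; rewrite lee_fin.
Qed.

Lemma ge0_expectation_prod (f : I -> U -> R) (s : seq I) : uniq s ->
  (forall k, measurable_fun setT (f k)) -> (forall k y, 0 <= f k y) ->
  (forall k, integrable_comp (f k) k) ->
  (\int[P]_x (\prod_(k <- s) f k (xi k x))%:E =
   (\prod_(k <- s) (\int[P]_x f k (xi k x))%R)%:E)%E.
Proof.
move=> us mf f0 intf.
have := @ge0_expectation_prod_indic f (fun=> setT) s [::].
rewrite cats0 big_nil mulr1 => <-//.
by apply: eq_integral => x _; rewrite big_nil mulr1.
Qed.

(** The absolute value of the product is a product of nonnegative independent factors, whose
    expectation is a finite product by [ge0_expectation_prod]. *)
Lemma integrable_prod (f : I -> U -> R) (s : seq I) : uniq s ->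
  (forall k, measurable_fun setT (f k)) ->
  (forall k, integrable_comp (f k) k) ->
  P.-integrable setT (fun x => (\prod_(k <- s) f k (xi k x))%:E).
Proof.
move=> us mf intf; apply/integrableP; split.
  apply/measurable_EFinP; apply: measurable_prod => k _.
  exact: measurableT_comp.
under eq_integral do rewrite abse_EFin normr_prod.
rewrite (@ge0_expectation_prod (fun k y => `|f k y|)) ?ltry//.
- by move=> k; exact: measurableT_comp.
- by move=> k; exact: integrable_norm (intf k).
Qed.

Lemma expectation_prod (f : I -> U -> R) (s : seq I) : uniq s ->
  (forall k, measurable_fun setT (f k)) ->
  (forall k, integrable_comp (f k) k) ->
  \int[P]_x (\prod_(k <- s) f k (xi k x)) =
  \prod_(k <- s) (\int[P]_x f k (xi k x)).
Proof.
(* The factors of [s2] are nonnegative; the others are split one at a time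
   into positive and negative parts. *)
rewrite -[s]cats0 => us mf intf.
have : forall k y, k \in [::] -> 0 <= f k y by [].
move: [::] us => s2 us; elim: s => [|k s ih] in s2 f us mf intf *.
  move=> f0; rewrite /= in us *.
  have e k : k \in s2 -> forall y, f k y = `|f k y|.
    by move=> ks2 y; rewrite ger0_norm// f0.
  have := @ge0_expectation_prod (fun k y => `|f k y|) s2 us.
  rewrite /Rintegral big_seq => H.
  transitivity (fine (\int[P]_x (\prod_(k <- s2) `|f k (xi k x)|)%:E)).
    congr fine; apply: eq_integral => x _; congr EFin.
    by rewrite big_seq [RHS]big_seq; apply: eq_bigr => k /e ->; rewrite normr_id.
  rewrite H//=.
  - rewrite [RHS]big_seq; apply: eq_bigr => k /e ke.
    by congr fine; apply: eq_integral => x _; rewrite [in RHS]ke.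
  - by move=> k; exact: measurableT_comp.
  - by move=> k; exact: integrable_norm (intf k).
move=> f0.
have /= /andP[] := us; rewrite mem_cat negb_or => /andP[ks ks2] us12.
(* [upd g] puts [g] in place of [f k]. For nonnegative [g] the index [k] may join [s2], so the
   induction hypothesis yields [key], which is then used for the positive and the negative part of
   [f k]. *)
pose upd (g : U -> R) j := if j == k then g else f j.
have updk g : upd g k = g by rewrite /upd eqxx.
have updE (g : U -> R) (F : I -> (U -> R) -> R) :
    \prod_(j <- s ++ s2) F j (upd g j) = \prod_(j <- s ++ s2) F j (f j).
  rewrite big_seq [RHS]big_seq; apply: eq_bigr => j js.
  rewrite /upd; case: eqP => // jk.
  by rewrite jk mem_cat (negbTE ks) (negbTE ks2) in js.
have usk : uniq (s ++ k :: s2) by rewrite -cat1s uniq_catCA cat1s.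
have key (g : U -> R) : measurable_fun setT g -> (forall y, 0 <= g y) ->
    integrable_comp g k ->
    P.-integrable setT
      (fun x => (g (xi k x) * \prod_(j <- s ++ s2) f j (xi j x))%:E) /\
    \int[P]_x (g (xi k x) * \prod_(j <- s ++ s2) f j (xi j x)) =
    (\int[P]_x g (xi k x)) * \prod_(j <- s ++ s2) \int[P]_x f j (xi j x).
  move=> mg g0 ig.
  have mupd j : measurable_fun setT (upd g j) by rewrite /upd; case: ifP.
  have iupd j : integrable_comp (upd g j) j.
    by rewrite /upd; case: eqP => // ->.
  split.
    have := @integrable_prod (upd g) (k :: s ++ s2) us mupd iupd.
    apply: eq_integrable => // x _; rewrite big_cons updk.
    by rewrite (updE g (fun j h => h (xi j x))).
  have := ih (k :: s2) (upd g) usk mupd iupd.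
  under eq_Rintegral => x _ .
    rewrite (perm_big (k :: s ++ s2)) /=; last first.
      by rewrite -[k :: s2]cat1s perm_catCA.
    rewrite big_cons updk (updE g (fun j h => h (xi j x))).
    over.
  rewrite (perm_big (k :: s ++ s2)) /=; last first.
    by rewrite -[k :: s2]cat1s perm_catCA.
  rewrite big_cons updk.
  rewrite (updE g (fun j h => \int[P]_x h (xi j x))); apply.
  move=> j y; rewrite inE /upd; case: eqP => //= jk js2; exact: f0.
have fE y : f k y = (f k)^\+ y - (f k)^\- y.
  by rewrite -[in LHS](funrposBneg (f k)).
have [ip ep] := key (f k)^\+ (measurable_funrpos (mf k))
  (@funrpos_ge0 _ _ _) (integrable_funrpos measurableT (intf k)).
have [iN eN] := key (f k)^\- (measurable_funrneg (mf k))
  (@funrneg_ge0 _ _ _) (integrable_funrneg measurableT (intf k)).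
rewrite /= big_cons.
under eq_Rintegral do rewrite big_cons fE mulrBl.
rewrite RintegralB// ep eN -mulrBl; congr (_ * _).
rewrite -RintegralB//; first by apply: eq_Rintegral => x _; rewrite -fE.
- exact: (integrable_funrpos measurableT (intf k)).
- exact: (integrable_funrneg measurableT (intf k)).
Qed.

End independence.

(** * Moments of the normal law *)

Section integrable_EFin.
Context {d : measure_display} {T : measurableType d} {R : realType}
  (P : probability T R).

Lemma integrableD_EFin (f g : T -> R) :
  P.-integrable setT (fun x => (f x)%:E) ->
  P.-integrable setT (fun x => (g x)%:E) ->
  P.-integrable setT (fun x => (f x + g x)%:E).
Proof. by move=> intf intg; exact: (integrableD measurableT intf intg). Qed.

Lemma integrableZl_EFin (r : R) (f : T -> R) :
  P.-integrable setT (fun x => (f x)%:E) ->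
  P.-integrable setT (fun x => (r * f x)%:E).
Proof. by move=> intf; exact: (integrableZl measurableT r intf). Qed.

Lemma integrable_cst_EFin (r : R) : P.-integrable setT (fun=> r%:E).
Proof. exact: finite_measure_integrable_cst. Qed.

Lemma Rintegral_cst_prob (r : R) : \int[P]_x r = r.
Proof.
rewrite Rintegral_cst//= -[RHS]mulr1; congr (_ * _).
by rewrite -[RHS]/(fine 1) -(@probability_setT _ _ _ P).
Qed.

(** Domination by [1 + Y ^+ 4], the constant being integrable under a probability. *)
Lemma integrable_expr2 (Y : T -> R) : measurable_fun setT Y ->
  P.-integrable setT (fun x => (Y x ^+ 4)%:E) ->
  P.-integrable setT (fun x => (Y x ^+ 2)%:E).
Proof.
move=> mY i4; have i14 := integrableD_EFin (integrable_cst_EFin 1) i4.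
apply: (le_integrable measurableT _ _ i14).
  by apply/measurable_EFinP; exact: measurable_funX.
move=> x _; rewrite !abse_EFin lee_fin ger0_norm ?sqr_ge0//.
apply: le_trans (ler_norm _).
by have := sqr_ge0 (Y x ^+ 2 - 1); nra.
Qed.

Lemma integrable_expr1 (Y : T -> R) : measurable_fun setT Y ->
  P.-integrable setT (fun x => (Y x ^+ 2)%:E) ->
  P.-integrable setT (fun x => (Y x)%:E).
Proof.
move=> mY i2; have i12 := integrableD_EFin (integrable_cst_EFin 1) i2.
apply: (le_integrable measurableT _ _ i12); first exact/measurable_EFinP.
move=> x _; rewrite !abse_EFin lee_fin.
apply: le_trans (ler_norm _).
rewrite -[X in 1 + X](real_normK (num_real _)).
by have := sqr_ge0 (`|Y x| - 1); nra.
Qed.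

End integrable_EFin.

Section normal_moments.
Context {d : measure_display} {T : measurableType d} {R : realType}
  (P : probability T R) (Y : T -> R).
Hypothesis mY : measurable_fun setT Y.

Let Ym : {mfun T >-> R} := HB.pack Y (isMeasurableFun.Build _ _ _ _ _ mY).

(** The reference measure [mu] is arbitrary so as to cover both the normal density with respect to
    Lebesgue measure and, for variance zero, the Dirac mass with density 1. *)
Let ge0_expectation_law (mu : {measure set (measurableTypeR R) -> \bar R}) (g f : R -> R) :
  (forall A, measurable A -> P (Y @^-1` A) = (\int[mu]_(x in A) (g x)%:E)%E) ->
  measurable_fun setT g -> (forall y, 0 <= g y) ->
  measurable_fun setT f -> (forall y, 0 <= f y) ->
  (\int[P]_x (f (Y x))%:E = \int[mu]_x (f x * g x)%:E)%E.
Proof.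
move=> PYg mg g0 mf f0.
rewrite (@ge0_integral_density _ _ _ _ _ mu (pushforward P Ym) id g 1)//.
- rewrite mul1e ge0_integral_pushforward//; first exact/measurable_EFinP.
  by move=> y _; rewrite lee_fin.
- move=> A mA; rewrite mul1e [RHS]PYg// [RHS]integral_mkcond.
  apply: eq_integral => x _; rewrite /patch indicE.
  by case: ifP => _; rewrite ?mul1r ?mul0r.
Qed.

Section nondegenerate.
Variable s : R.
Hypothesis s0 : 0 < s.
Hypothesis Ylaw : forall A, measurable A -> P (Y @^-1` A) = normal_prob 0 s A.

Let law_pdf (f : R -> R) :
  measurable_fun setT f -> (forall y, 0 <= f y) ->
  (\int[P]_x (f (Y x))%:E =
   \int[lebesgue_measure]_x (f x * normal_pdf 0 s x)%:E)%E.
Proof.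
move=> mf f0.
apply: (@ge0_expectation_law lebesgue_measure (normal_pdf 0 s) f) => //.
  exact: measurable_normal_pdf.
by move=> y; exact: normal_pdf_ge0.
Qed.

(* Both exponential integrals are total masses of normal densities: the first
   shifts the mean, the second changes the variance. Together with
   [1 + u <= expR u] they determine the first two moments. *)
Let normal_expectation_expR_lin (m : R) :
  (\int[P]_x (expR ((m * Y x - m ^+ 2 / 2) / s ^+ 2))%:E = 1)%E.
Proof.
rewrite (@law_pdf (fun y => expR ((m * y - m ^+ 2 / 2) / s ^+ 2))).
- rewrite -(integral_normal_pdf m s); apply: eq_integral => x _.
  rewrite !normal_pdfE ?gt_eqF// mulrCA /normal_fun -expRD; congr (_ * expR _)%:E.
  by field; rewrite gt_eqF.
- apply: measurableT_comp => //; apply: measurable_funM => //.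
  by apply: measurable_funB => //; exact: measurable_funM.
- by move=> y; exact: expR_ge0.
Qed.

Let normal_expectation_expR_sqr (t : R) : 0 < t ->
  (\int[P]_x (expR (((s ^- 2 - t ^- 2) / 2) * Y x ^+ 2))%:E = (t / s)%:E)%E.
Proof.
move=> t0.
rewrite (@law_pdf (fun y => expR (((s ^- 2 - t ^- 2) / 2) * y ^+ 2))).
- rewrite -[RHS]mule1 -(integral_normal_pdf 0 t) -ge0_integralZl_EFin//.
  + apply: eq_integral => x _; rewrite -EFinM; congr EFin.
    have peakE (r : R) : 0 < r -> normal_peak r = r^-1 * normal_peak 1.
      move=> r0; rewrite /normal_peak expr1n mul1r -mulrnAr sqrtrM ?sqr_ge0//.
      by rewrite sqrtr_sqr gtr0_norm// invfM.
    rewrite !normal_pdfE ?gt_eqF// (peakE s)// (peakE t)// mulrCA /normal_fun.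
    rewrite -expRD subr0.
    have -> (p e : R) : t / s * (t^-1 * p * e) = s^-1 * p * e.
      by field; rewrite !gt_eqF.
    congr (_ * expR _).
    by field; rewrite !gt_eqF.
  + by move=> x _; rewrite lee_fin normal_pdf_ge0.
  + by apply/measurable_EFinP; exact: measurable_normal_pdf.
  + by rewrite divr_ge0// ltW.
- apply: measurableT_comp => //; apply: measurable_funM => //.
- by move=> y; exact: expR_ge0.
Qed.

Let normal_integrable_expR_sqr (t : R) : 0 < t ->
  P.-integrable setT
    (fun x => (expR (((s ^- 2 - t ^- 2) / 2) * Y x ^+ 2))%:E).
Proof.
move=> t0; apply/integrableP; split.
  apply/measurable_EFinP; apply: measurableT_comp => //.
  by apply: measurable_funM => //; exact: measurable_funX.
under eq_integral do rewrite gee0_abs ?lee_fin ?expR_ge0//.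
by rewrite normal_expectation_expR_sqr// ltry.
Qed.

(** For [u >= 0], [(u / 2) ^+ 2 <= expR u], because [u / 2 <= expR (u / 2)]. With [u = k * Y ^+ 2]
    the right side is the exponential integral of the variance change to [t = 2 * s]. A constant
    multiple of [s ^+ 4] is what the strong law for squares will use. *)
Let normal_expr4 : P.-integrable setT (fun x => (Y x ^+ 4)%:E) /\
  \int[P]_x (Y x ^+ 4) <= 60 * s ^+ 4.
Proof.
pose k := (s ^- 2 - (2 * s) ^- 2) / 2.
have kE : k = 3 / 8 * s ^- 2 by rewrite /k; field; rewrite gt_eqF.
have k0 : 0 < k by rewrite kE mulr_gt0// invr_gt0 exprn_gt0.
have s20 : 0 < 2 * s by rewrite mulr_gt0.
have i2 := normal_integrable_expR_sqr s20.
have Yle x : Y x ^+ 4 <= 4 / k ^+ 2 * expR (k * Y x ^+ 2).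
  have Y0 : 0 <= k * Y x ^+ 2 by rewrite mulr_ge0 ?sqr_ge0// ltW.
  have -> : Y x ^+ 4 = 4 / k ^+ 2 * ((k * Y x ^+ 2) / 2) ^+ 2.
    by field; rewrite gt_eqF.
  rewrite ler_wpM2l//; first by rewrite divr_ge0// sqr_ge0.
  rewrite [in leRHS](splitr (k * _)) expRD -expr2 lerXn2r ?nnegrE ?expR_ge0//.
    by rewrite divr_ge0.
  by rewrite (le_trans _ (expR_ge1Dx _))// lerDr.
have i2' := integrableZl_EFin (4 / k ^+ 2) i2.
have i4 : P.-integrable setT (fun x => (Y x ^+ 4)%:E).
  apply: (le_integrable measurableT _ _ i2').
    by apply/measurable_EFinP; exact: measurable_funX.
  move=> x _; rewrite !abse_EFin lee_fin -/k.
  by rewrite ger0_norm ?exprn_even_ge0// (le_trans (Yle x))// ler_norm.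
split => //; apply: (le_trans (le_Rintegral measurableT i4 i2' _)) => //.
rewrite RintegralZl// /Rintegral normal_expectation_expR_sqr//= kE.
(* The factor [2 * s / s] is the value [t / s] of the exponential integral; 60 is a round bound for
   512 / 9. *)
have -> : 4 / (3 / 8 * s ^- 2) ^+ 2 * (2 * s / s) = 512 / 9 * s ^+ 4.
  by field; rewrite gt_eqF.
by rewrite ler_wpM2r ?exprn_ge0 ?ltW//; lra.
Qed.

Lemma normal_prob_moments :
  [/\ P.-integrable setT (fun x => (Y x ^+ 4)%:E),
      \int[P]_x (Y x ^+ 4) <= 60 * s ^+ 4,
      \int[P]_x Y x = 0 & \int[P]_x (Y x ^+ 2) = s ^+ 2].
Proof.
have [i4 b4] := normal_expr4.
have i2 := integrable_expr2 mY i4.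
have i1 := integrable_expr1 mY i2.
have icst := @integrable_cst_EFin _ _ _ P.
have P1 := @Rintegral_cst_prob _ _ _ P.
split => //.
- set e := \int[P]_x Y x.
  (* Integrating [1 + u <= expR u], where the exponential has integral 1, leaves a nonpositive mean
     for [u]. At [m = e] this reads [e ^+ 2 <= e ^+ 2 / 2], so [e = 0]. *)
  have mle (m : R) : m * e <= m ^+ 2 / 2.
    have ie : P.-integrable setT
        (fun x => (expR ((m * Y x - m ^+ 2 / 2) / s ^+ 2))%:E).
      apply/integrableP; split.
        apply/measurable_EFinP; apply: measurableT_comp => //.
        apply: measurable_funM => //; apply: measurable_funB => //.
        exact: measurable_funM.
      under eq_integral do rewrite gee0_abs ?lee_fin ?expR_ge0//.
      by rewrite normal_expectation_expR_lin ltry.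
    have il : P.-integrable setT
        (fun x => ((1 - m ^+ 2 / 2 / s ^+ 2) + m / s ^+ 2 * Y x)%:E).
      exact: integrableD_EFin (icst _) (integrableZl_EFin _ i1).
    have := le_Rintegral measurableT il ie.
    have -> : \int[P]_x expR ((m * Y x - m ^+ 2 / 2) / s ^+ 2) = 1.
      by rewrite /Rintegral normal_expectation_expR_lin.
    rewrite RintegralD; [|by []|exact: icst|exact: integrableZl_EFin].
    rewrite P1 RintegralZl// -/e => H.
    have : 1 - m ^+ 2 / 2 / s ^+ 2 + m / s ^+ 2 * e <= 1.
      apply: H => x _; apply: le_trans (expR_ge1Dx _).
      by rewrite le_eqVlt; apply/orP; left; apply/eqP; field; rewrite gt_eqF.
    rewrite -subr_ge0.
    have -> : 1 - (1 - m ^+ 2 / 2 / s ^+ 2 + m / s ^+ 2 * e) =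
              (m ^+ 2 / 2 - m * e) / s ^+ 2 by field; rewrite gt_eqF.
    by rewrite pmulr_lge0 ?subr_ge0// invr_gt0 exprn_gt0.
  have := mle e; have := sqr_ge0 e; rewrite expr2 => e0 e1.
  have : e * e = 0 by lra.
  by move/eqP; rewrite mulf_eq0 orbb => /eqP.
- set r := \int[P]_x (Y x ^+ 2).
  have r0 : 0 <= r by apply: Rintegral_ge0 => x _; exact: sqr_ge0.
  (* The same convexity bound gives [1 + (s ^- 2 - t ^- 2) / 2 * r <= t / s], here cleared of
     denominators. *)
  have key (t : R) : 0 < t -> 0 <= (t - s) * (2 * s * t ^+ 2 - (s + t) * r).
    move=> t0.
    have ie := normal_integrable_expR_sqr t0.
    have il : P.-integrable setT
        (fun x => (1 + (s ^- 2 - t ^- 2) / 2 * Y x ^+ 2)%:E).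
      exact: integrableD_EFin (icst _) (integrableZl_EFin _ i2).
    have := le_Rintegral measurableT il ie.
    have -> : \int[P]_x expR ((s ^- 2 - t ^- 2) / 2 * Y x ^+ 2) = t / s.
      by rewrite /Rintegral normal_expectation_expR_sqr.
    rewrite RintegralD; [|by []|exact: icst|exact: integrableZl_EFin].
    rewrite P1 RintegralZl// -/r => H.
    have : 1 + (s ^- 2 - t ^- 2) / 2 * r <= t / s.
      by apply: H => x _; exact: expR_ge1Dx.
    rewrite -subr_ge0.
    have -> : t / s - (1 + (s ^- 2 - t ^- 2) / 2 * r) =
              (t - s) * (2 * s * t ^+ 2 - (s + t) * r) / (2 * s ^+ 2 * t ^+ 2).
      by field; rewrite !gt_eqF.
    by rewrite pmulr_lge0// invr_gt0 !mulr_gt0// exprn_gt0.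
  (* If [r = 0], then [key] at [t = s / 2] would make [- (s ^+ 4 / 4)] nonnegative; so [r > 0] and
     its square root is an admissible [t]. *)
  have [r_eq0|rN0] := eqVneq r 0.
    have := key (s / 2) (divr_gt0 s0 (ltr0Sn _ 1)).
    have s3 : 0 < s ^+ 4 by rewrite exprn_gt0.
    rewrite r_eq0 mulr0 subr0 => H.
    have : (s / 2 - s) * (2 * s * (s / 2) ^+ 2) = - (s ^+ 4 / 4) by field.
    by move=> E; move: H; rewrite E; lra.
  (* [t := sqrt r] turns [key] into [0 <= - (t * (t - s)) ^+ 2]. *)
  have q0 : 0 < Num.sqrt r by rewrite sqrtr_gt0 lt_neqAle eq_sym rN0.
  have := key _ q0; rewrite -[in X in _ * (_ - _ * X)](sqr_sqrtr r0).
  set q := Num.sqrt r in q0 *.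
  have -> : (q - s) * (2 * s * q ^+ 2 - (s + q) * q ^+ 2) =
            - (q * (q - s)) ^+ 2 by ring.
  rewrite oppr_ge0 => qs.
  have : (q * (q - s)) ^+ 2 == 0 by rewrite eq_le qs sqr_ge0.
  rewrite sqrf_eq0 mulf_eq0 gt_eqF//= subr_eq0 => /eqP <-.
  by rewrite sqr_sqrtr.
Qed.

End nondegenerate.

(** Taps of zero power are allowed, so [v = 0] is treated apart: under the Dirac mass, every
    nonnegative function vanishing at 0 has zero expectation. *)
Lemma normal0_law_moments (v : R) : 0 <= v ->
  (forall A, measurable A -> P (Y @^-1` A) = normal0_law v A) ->
  [/\ P.-integrable setT (fun x => (Y x ^+ 4)%:E),
      \int[P]_x (Y x ^+ 4) <= 60 * v ^+ 2,
      \int[P]_x Y x = 0 & \int[P]_x (Y x ^+ 2) = v].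
Proof.
rewrite /normal0_law le_eqVlt => /predU1P[<-|v0] Ylaw; last first.
  have s0 : 0 < Num.sqrt v by rewrite sqrtr_gt0.
  have [|i4 b4 e1 e2] := normal_prob_moments s0.
    by move=> A /Ylaw ->; rewrite gt_eqF.
  have v2 : Num.sqrt v ^+ 2 = v by rewrite sqr_sqrtr// ltW.
  by split => //; rewrite -v2 // -exprM.
have E0 (f : R -> R) : measurable_fun setT f -> (forall y, 0 <= f y) -> f 0 = 0 ->
    (\int[P]_x (f (Y x))%:E = 0)%E.
  move=> mf f0 f00.
  rewrite (@ge0_expectation_law (\d_(0 : measurableTypeR R)) (cst 1) f)//.
    rewrite integral_dirac//=.
      rewrite [X in (_ * X)%E](_ : _ = 0%E) ?mule0//.
      by congr EFin; rewrite mulr1; exact: f00.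
    by apply/measurable_EFinP; exact: measurable_funM.
  move=> A mA; rewrite Ylaw// eqxx.
  by under eq_integral do rewrite /=; rewrite [RHS]integral_cst// mul1e.
split.
- apply/integrableP; split.
    by apply/measurable_EFinP; exact: measurable_funX.
  under eq_integral do rewrite abse_EFin.
  rewrite (E0 (fun y => `|y ^+ 4|)) ?ltry ?expr0n ?normr0//.
  by apply: measurableT_comp => //; exact: exprn_measurable.
- rewrite /Rintegral (E0 (fun y => y ^+ 4)) ?expr0n ?mulr0//.
  by move=> y; rewrite exprn_even_ge0.
- apply/eqP; rewrite -normr_eq0 eq_le normr_ge0 andbT.
  have iY : P.-integrable setT (EFin \o Y).
    apply/integrableP; split; first exact/measurable_EFinP.
    under eq_integral do rewrite abse_EFin.
    by rewrite (E0 (fun y => `|y|)) ?ltry ?normr0.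
  rewrite (le_trans (le_normr_Rintegral measurableT iY))//.
  by rewrite /Rintegral (E0 (fun y => `|y|)) ?normr0.
- rewrite /Rintegral (E0 (fun y => y ^+ 2)) ?expr0n//.
  by move=> y; exact: sqr_ge0.
Qed.

End normal_moments.

(** * Real and imaginary marginals of complex normal variables *)

Section complex_normal.
Context {d : measure_display} {T : measurableType d} {R : realType}
  (P : probability T R).

Let normal0_lawT (v : R) : normal0_law v setT = 1%E.
Proof.
rewrite /normal0_law; case: eqP => [_|_]; first by rewrite diracT.
exact: (@probability_setT _ _ _ (normal_prob 0 (Num.sqrt v))).
Qed.

Lemma complex_normal0_marginals (v : R) (X : T -> R[i]) (A : set R) :
  complex_normal0 P v X -> measurable A ->
  P ((fun w => complex.Re (X w)) @^-1` A) = normal0_law (v / 2) A /\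
  P ((fun w => complex.Im (X w)) @^-1` A) = normal0_law (v / 2) A.
Proof.
move=> [_ law] mA; split.
  have := law A setT mA measurableT; rewrite normal0_lawT mule1 => <-.
  by congr (P _); apply/seteqP; split => w /= => [|[]].
have := law setT A measurableT mA; rewrite normal0_lawT mul1e => <-.
by congr (P _); apply/seteqP; split => w /= => [|[]].
Qed.

End complex_normal.

(** * A strong law of large numbers for orthogonal variables *)

Section finite_sums.
Context {d : measure_display} {T : measurableType d} {R : realType}
  (P : probability T R).

Lemma integrable_sum_EFin (I : Type) (s : seq I) (f : I -> T -> R) :
  (forall i, P.-integrable setT (fun x => (f i x)%:E)) ->
  P.-integrable setT (fun x => (\sum_(i <- s) f i x)%:E).
Proof.
move=> intf; elim: s => [|i s ih].
  by under eq_fun do rewrite big_nil; exact: integrable_cst_EFin.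
by under eq_fun do rewrite big_cons; exact: integrableD_EFin.
Qed.

Lemma Rintegral_sum (I : Type) (s : seq I) (f : I -> T -> R) :
  (forall i, P.-integrable setT (fun x => (f i x)%:E)) ->
  \int[P]_x (\sum_(i <- s) f i x) = \sum_(i <- s) \int[P]_x f i x.
Proof.
move=> intf; elim: s => [|i s ih].
  by under eq_Rintegral do rewrite big_nil; rewrite big_nil Rintegral_cst_prob.
under eq_Rintegral do rewrite big_cons.
rewrite big_cons RintegralD ?ih//; first exact: intf.
exact: integrable_sum_EFin.
Qed.

End finite_sums.

Section strong_law.
Context {d : measure_display} {T : measurableType d} {R : realType}
  (P : probability T R) (X : nat -> T -> R) (C : R).
Hypothesis intX : forall j k,
  P.-integrable setT (fun x => (X j x * X k x)%:E).
Hypothesis X_orth : forall j k, j != k -> \int[P]_x (X j x * X k x) = 0.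
Hypothesis X_var : forall k, \int[P]_x (X k x * X k x) <= C.

Let S (a b : nat) x := \sum_(a <= k < b) X k x.

Let S_sqr a b x :
  S a b x ^+ 2 =
  \sum_(j <- index_iota a b) \sum_(k <- index_iota a b) X j x * X k x.
Proof. by rewrite expr2 /S big_distrlr. Qed.

Let integrable_S_sqr a b : P.-integrable setT (fun x => (S a b x ^+ 2)%:E).
Proof.
under eq_fun do rewrite S_sqr.
by apply: integrable_sum_EFin => j; exact: integrable_sum_EFin.
Qed.

(** Orthogonality kills the off-diagonal terms of the expanded square, leaving one variance per
    index. *)
Let expectation_S_sqr a b : \int[P]_x (S a b x ^+ 2) <= (b - a)%:R * C.
Proof.
under eq_Rintegral do rewrite S_sqr.
rewrite Rintegral_sum; last by move=> j; exact: integrable_sum_EFin.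
apply: (@le_trans _ _ (\sum_(j <- index_iota a b) C)).
  rewrite big_seq [leRHS]big_seq; apply: ler_sum => j js.
  rewrite Rintegral_sum; last by [].
  rewrite (bigD1_seq j)//= ?iota_uniq// big1 ?addr0//.
  by move=> k kj; rewrite X_orth// eq_sym.
by rewrite sumr_const_nat mulr_natl.
Qed.

(* Summability of the [W m] is what upgrades the L2 bound to almost sure
   convergence. Block [m] controls the partial sums up to the indices in
   [[m.+1 ^ 2, m.+2 ^ 2[[: its value at the left end and its oscillation. *)
Let W (m : nat) x := (S 0 (m.+1 ^ 2) x ^+ 2 +
  \sum_(j <- iota 0 (m.+1).*2.+1) S (m.+1 ^ 2) (m.+1 ^ 2 + j) x ^+ 2)
  / m.+1%:R ^+ 4.

Let W_ge0 m x : 0 <= W m x.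
Proof.
rewrite divr_ge0 ?exprn_ge0// addr_ge0 ?sqr_ge0// sumr_ge0// => j _.
exact: sqr_ge0.
Qed.

Let C_ge0 : 0 <= C.
Proof.
apply: le_trans (X_var 0); apply: Rintegral_ge0 => x _.
by rewrite -expr2 sqr_ge0.
Qed.

Let integrable_W m : P.-integrable setT (fun x => (W m x)%:E).
Proof.
under eq_fun do rewrite /W mulrC.
apply: integrableZl_EFin; apply: integrableD_EFin => //.
by apply: integrable_sum_EFin => j; exact: integrable_S_sqr.
Qed.

(** Write [N] for [m.+1]. The left end contributes at most [N ^+ 2 * C]. The oscillation has
    [2 * N + 1] terms of at most [2 * N * C] each, hence at most [6 * N ^+ 2 * C]. Together this
    makes 7. *)
Let expectation_W m : \int[P]_x W m x <= 7 * C / m.+1%:R ^+ 2.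
Proof.
under eq_Rintegral do rewrite /W mulrC.
have iS : P.-integrable setT (fun x => (\sum_(j <- iota 0 (m.+1).*2.+1)
    S (m.+1 ^ 2) (m.+1 ^ 2 + j) x ^+ 2)%:E).
  by apply: integrable_sum_EFin => j; exact: integrable_S_sqr.
rewrite RintegralZl//; last exact: integrableD_EFin.
rewrite RintegralD//; last exact: integrable_S_sqr.
rewrite Rintegral_sum//.
have N0 : (0 < m.+1%:R :> R) by rewrite ltr0n.
have h1 : \int[P]_x (S 0 (m.+1 ^ 2) x ^+ 2) <= m.+1%:R ^+ 2 * C.
  by have := expectation_S_sqr 0 (m.+1 ^ 2); rewrite subn0 natrX.
have h2 : \sum_(j <- iota 0 (m.+1).*2.+1)
    \int[P]_x (S (m.+1 ^ 2) (m.+1 ^ 2 + j) x ^+ 2) <= 6 * m.+1%:R ^+ 2 * C.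
  apply: (@le_trans _ _ (\sum_(j <- iota 0 (m.+1).*2.+1) 2 * m.+1%:R * C)).
    rewrite big_seq [leRHS]big_seq; apply: ler_sum => j.
    rewrite mem_iota add0n ltnS => jm.
    apply: (le_trans (expectation_S_sqr _ _)); rewrite addKn ler_wpM2r//.
    by rewrite -natrM ler_nat mul2n.
  rewrite big_const_seq count_predT size_iota iter_addr_0 -[leLHS]mulr_natl.
  rewrite -muln2 -[(_ * 2).+1]addn1 natrD natrM mulrA ler_wpM2r//.
  have : 1 <= m.+1%:R :> R by rewrite ler1n.
  by nra.
have -> : 7 * C / m.+1%:R ^+ 2 = (m.+1%:R ^+ 4)^-1 *
    (m.+1%:R ^+ 2 * C + 6 * m.+1%:R ^+ 2 * C).
  by field; rewrite gt_eqF.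
by rewrite ler_wpM2l ?lerD// invr_ge0 exprn_ge0.
Qed.

Let sum_inv_sqr_le n : \sum_(0 <= m < n) (m.+1%:R ^+ 2)^-1 <= 2 :> R.
Proof.
case: n => [|n]; first by rewrite big_geq.
(* The stronger bound, with the reciprocal subtracted, is the one that passes through the
   induction. *)
suff : \sum_(0 <= m < n.+1) (m.+1%:R ^+ 2)^-1 <= 2 - n.+1%:R^-1 :> R.
  by move/le_trans; apply; rewrite gerBl invr_ge0.
elim: n => [|n ih]; first by rewrite big_nat1 expr1n invr1; lra.
rewrite big_nat_recr//=; apply: (le_trans (lerD ih (lexx _))).
rewrite -subr_ge0 -(natr1 n.+1).
have n0 : 0 < n.+1%:R :> R by rewrite ltr0n.
set N := n.+1%:R in n0 *.
have -> : 2 - (N + 1)^-1 - (2 - N^-1 + ((N + 1) ^+ 2)^-1) =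
          (N * (N + 1) ^+ 2)^-1.
  by field; rewrite !gt_eqF// addr_gt0.
by rewrite invr_ge0 mulr_ge0 ?sqr_ge0// ltW.
Qed.

(** By monotone convergence the expected sum of the series is at most [7 * C * 2]; an integrable
    series is finite almost everywhere, and its value bounds all partial sums. *)
Let summable_W : {ae P, forall x, exists M : R,
  forall n, \sum_(0 <= m < n) W m x <= M}.
Proof.
have mW m : measurable_fun setT (fun x => (W m x)%:E).
  exact: measurable_int (integrable_W m).
pose F x := (\sum_(m <oo) (W m x)%:E)%E.
have F0 x : (0 <= F x)%E by apply: nneseries_ge0 => m _ _; rewrite lee_fin.
have intF : (\int[P]_x F x <= (7 * C * 2)%:E)%E.
  rewrite integral_nneseries//; last by move=> m x _; rewrite lee_fin.
  apply: lime_le.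
    by apply: is_cvg_nneseries => m _ _; apply: integral_ge0 => x _; rewrite lee_fin.
  apply: nearW => n.
  apply: (@le_trans _ _ (\sum_(0 <= m < n) (7 * C * (m.+1%:R ^+ 2)^-1)%:E)%E).
    apply: lee_sum => m _.
    rewrite -[leLHS]fineK; last exact: integrable_fin_num (integrable_W m).
    by rewrite lee_fin; exact: expectation_W.
  rewrite sumEFin lee_fin -mulr_sumr ler_wpM2l ?sum_inv_sqr_le//.
  by rewrite mulr_ge0.
have : P.-integrable setT F.
  apply/integrableP; split.
    by apply: ge0_emeasurable_sum => // m x _ _; rewrite lee_fin.
  under eq_integral do rewrite gee0_abs//.
  by rewrite (le_lt_trans intF)// ltry.
move/(integrable_ae measurableT); apply: filterS => x /(_ I) Ffin.
exists (fine (F x)) => n; rewrite -lee_fin fineK// -sumEFin.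
by apply: nneseries_lim_ge => m _; rewrite lee_fin.
Qed.

Let sqrt_block n : exists N, (N ^ 2 <= n < N.+1 ^ 2)%N.
Proof.
elim: n => [|n [N /andP[Nn nN]]]; first by exists 0.
have [n1|n1] := leqP (N.+1 ^ 2) n.+1.
  exists N.+1; rewrite n1 /=; apply: leq_ltn_trans nN _.
  by rewrite ltn_exp2r.
by exists N; rewrite n1 (leq_trans Nn).
Qed.

Theorem slln_orthogonal : {ae P, forall x,
  n%:R^-1 * (\sum_(0 <= k < n) X k x) @[n --> \oo] --> (0 : R)}.
Proof.
move: summable_W; apply: filterS => x [M WM].
have W0 : W m x @[m --> \oo] --> (0 : R).
  apply: cvg_series_cvg_0; apply: nondecreasing_is_cvgn.
    apply/nondecreasing_seqP => n; rewrite /series/= big_nat_recr//=.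
    by rewrite lerDl.
  by exists M => _ [n _ <-]; exact: WM.
apply/cvgrPdist_lt => e e0.
(* The half compensates the factor 2 in [(A + B) ^+ 2 <= 2 * (A ^+ 2 + B ^+ 2)] used at the end. *)
have e2 : 0 < e ^+ 2 / 2 by rewrite divr_gt0// exprn_gt0.
have [m0 _ Wm] := (@cvgrPdist_lt _ _ _ _ _ _ _).1 W0 _ e2.
(* Past this square, the block [[m.+1 ^ 2, m.+2 ^ 2[] containing [n] has [m0 <= m]; the block of
   [n = 0] is excluded too. *)
exists (m0.+1 ^ 2)%N => // n /= m0n; rewrite sub0r normrN.
have [[|m] /andP[mn nm]] := sqrt_block n.
  by move: nm; rewrite exp1n ltnNge (leq_trans _ m0n)// expn_gt0.
have m0m : (m0 <= m)%N by rewrite leqNgt; apply/negP; nia.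
have := Wm m m0m; rewrite /= sub0r normrN ger0_norm//.
pose j := (n - m.+1 ^ 2)%N.
have jE : n = (m.+1 ^ 2 + j)%N by rewrite /j subnKC.
have -> : \sum_(0 <= k < n) X k x = S 0 (m.+1 ^ 2) x + S (m.+1 ^ 2) (m.+1 ^ 2 + j) x.
  by rewrite /S -jE -big_cat_nat.
have : S (m.+1 ^ 2) (m.+1 ^ 2 + j) x ^+ 2 <= \sum_(j <- iota 0 (m.+1).*2.+1)
    S (m.+1 ^ 2) (m.+1 ^ 2 + j) x ^+ 2.
  have jN : j \in iota 0 (m.+1).*2.+1 by rewrite mem_iota add0n -muln2; nia.
  rewrite (bigD1_seq j jN (iota_uniq _ _))/=.
  by rewrite lerDl sumr_ge0// => k _; exact: sqr_ge0.
rewrite /W.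
set A := S 0 _ x; set B := S _ (_ + j) x; set D := \sum_(j <- _) _ => BD.
have N0 : (0 < m.+1%:R :> R) by rewrite ltr0n.
have n0 : (0 < n%:R :> R) by rewrite ltr0n (leq_trans _ mn)// expn_gt0.
have Nn : m.+1%:R ^+ 2 <= n%:R :> R by rewrite -natrX ler_nat.
rewrite ltr_pdivrMr ?exprn_gt0// => ABD.
rewrite normrM gtr0_norm ?invr_gt0// mulrC ltr_pdivrMr//.
rewrite -ltr_sqr ?nnegrE// ?mulr_ge0 ?ltW//.
rewrite real_normK ?num_real// exprMn.
apply: (@lt_le_trans _ _ (e ^+ 2 * (m.+1%:R ^+ 2) ^+ 2)); last first.
  by rewrite ler_wpM2l ?sqr_ge0// ler_sqr ?nnegrE// ?sqr_ge0// ltW.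
rewrite -exprM; apply: (@le_lt_trans _ _ (2 * (A ^+ 2 + D))); last by lra.
have := sqr_ge0 (A - B); nra.
Qed.

End strong_law.

(** * Limits of real and complex sequences *)

Local Notation normc := ComplexField.Normc.normc.
Local Open Scope complex_scope.

(** Identities that simplify [n%:R / n%:R] fail for an empty array; this lets them be used for
    [n > 0] only. *)
Lemma cvg_eq_gt0 (R : realType) (f g : nat -> R) (l : R) :
  (forall n, (0 < n)%N -> f n = g n) ->
  f n @[n --> \oo] --> l -> g n @[n --> \oo] --> l.
Proof.
move=> fg fl; apply: (cvg_trans _ fl); apply: near_eq_cvg.
by exists 1%N => // n /= /fg.
Qed.

Lemma cvg_sum_cond (R : realType) (I : Type) (s : seq I) (Q : pred I)
    (f : I -> nat -> R) (l : I -> R) :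
  (forall i, Q i -> f i n @[n --> \oo] --> l i) ->
  \sum_(i <- s | Q i) f i n @[n --> \oo] --> \sum_(i <- s | Q i) l i.
Proof.
move=> fl; elim: s => [|i s ih].
  by under eq_fun do rewrite big_nil; rewrite big_nil; exact: cvg_cst.
under eq_fun do rewrite big_cons; rewrite big_cons.
by case: ifPn => // Qi; apply: cvgD => //; exact: fl.
Qed.

Section complex_cvg.
Context {R : realType}.
Implicit Types (z : nat -> R[i]) (c l : R[i]).

(** Componentwise, so that every limit is taken in [R], where the strong law provides it. *)
Definition ccvg z l : Prop :=
  complex.Re (z n) @[n --> \oo] --> complex.Re l /\
  complex.Im (z n) @[n --> \oo] --> complex.Im l.

Lemma ccvg_cst l : ccvg (fun=> l) l.
Proof. by split; exact: cvg_cst. Qed.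

Lemma ccvgD z1 z2 l1 l2 :
  ccvg z1 l1 -> ccvg z2 l2 -> ccvg (fun n => z1 n + z2 n) (l1 + l2).
Proof.
move=> [r1 i1] [r2 i2]; split.
  under eq_fun do rewrite raddfD; rewrite raddfD; exact: cvgD.
by under eq_fun do rewrite raddfD; rewrite raddfD; exact: cvgD.
Qed.

Lemma ccvgZ c z l : ccvg z l -> ccvg (fun n => c * z n) (c * l).
Proof.
have ReM (u v : R[i]) : complex.Re (u * v) =
    complex.Re u * complex.Re v - complex.Im u * complex.Im v.
  by case: u; case: v.
have ImM (u v : R[i]) : complex.Im (u * v) =
    complex.Re u * complex.Im v + complex.Im u * complex.Re v.
  by case: u; case: v.
move=> [r i]; split.
  under eq_fun do rewrite ReM; rewrite ReM.
  by apply: cvgB; apply: cvgMr.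
under eq_fun do rewrite ImM; rewrite ImM.
by apply: cvgD; apply: cvgMr.
Qed.

Lemma ccvg_sum (I : Type) (s : seq I) (z : I -> nat -> R[i]) (l : I -> R[i]) :
  (forall i, ccvg (z i) (l i)) ->
  ccvg (fun n => \sum_(i <- s) z i n) (\sum_(i <- s) l i).
Proof.
move=> zl; elim: s => [|i s ih].
  by under eq_fun do rewrite big_nil; rewrite big_nil; exact: ccvg_cst.
under eq_fun do rewrite big_cons.
by rewrite big_cons; exact: ccvgD.
Qed.

Lemma normc_sqr (u : R[i]) :
  normc u ^+ 2 = complex.Re u ^+ 2 + complex.Im u ^+ 2.
Proof. by case: u => a b /=; rewrite sqr_sqrtr// addr_ge0// sqr_ge0. Qed.

Lemma normc_sqr_conj (u : R[i]) : normc u ^+ 2 = complex.Re (u * conjc u).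
Proof. by rewrite normc_sqr; case: u => a b /=; rewrite mulrN opprK. Qed.

Lemma normcM (u v : R[i]) : normc (u * v) = normc u * normc v.
Proof. exact: ComplexField.Normc.normcM. Qed.

Lemma normcR_sqr (r : R) : normc r%:C ^+ 2 = r ^+ 2.
Proof. by rewrite normc_sqr /= expr0n addr0. Qed.

Lemma ccvg_normc_sqr z l :
  ccvg z l -> normc (z n) ^+ 2 @[n --> \oo] --> normc l ^+ 2.
Proof.
move=> [r i]; under eq_fun do rewrite normc_sqr.
rewrite normc_sqr; apply: cvgD.
  by under eq_fun do rewrite expr2; rewrite expr2; exact: cvgM.
by under eq_fun do rewrite expr2; rewrite expr2; exact: cvgM.
Qed.

End complex_cvg.

(** * Limits of the channel gains *)

Section dot_products.
Context {R : realType}.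
Local Notation C := R[i].

Lemma dotTE n (u v : 'cV[C]_n) : dotT u v = \sum_(k < n) u k 0 * v k 0.
Proof. by rewrite /dotT mxE; apply: eq_bigr => k _; rewrite mxE. Qed.

Lemma dotTC n (u v : 'cV[C]_n) : dotT u v = dotT v u.
Proof. by rewrite !dotTE; apply: eq_bigr => k _; rewrite mulrC. Qed.

Lemma dotTZr n (c : C) (u v : 'cV[C]_n) : dotT u (c *: v) = c * dotT u v.
Proof.
by rewrite !dotTE mulr_sumr; apply: eq_bigr => k _; rewrite mxE mulrCA.
Qed.

Lemma vnorm_sqr n (u : 'cV[C]_n) :
  vnorm u ^+ 2 = complex.Re (dotT u (map_mx conjc u)).
Proof.
rewrite /vnorm sqr_sqrtr; last by apply: sumr_ge0 => k _; exact: sqr_ge0.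
rewrite dotTE raddf_sum; apply: eq_bigr => k _.
by rewrite normc_sqr_conj mxE.
Qed.

(** Reduces all products of combinations of taps to the entries of the unnormalized Gram matrix. *)
Lemma dotT_comb (L : nat) (a : 'I_L -> nat -> C) (c d : 'I_L -> C) n :
  dotT (\sum_p c p *: \col_(k < n) a p k)
       (map_mx conjc (\sum_q d q *: \col_(k < n) a q k)) =
  \sum_p \sum_q c p * conjc (d q) * \sum_(k < n) a p k * conjc (a q k).
Proof.
rewrite dotTE.
transitivity (\sum_(k < n) \sum_p \sum_q
    c p * conjc (d q) * (a p k * conjc (a q k))).
  apply: eq_bigr => k _; rewrite !mxE !summxE rmorph_sum mulr_suml.
  apply: eq_bigr => p _; rewrite mulr_sumr; apply: eq_bigr => q _.
  by rewrite !mxE rmorphM mulrACA.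
rewrite exchange_big; apply: eq_bigr => p _.
rewrite exchange_big; apply: eq_bigr => q _.
by rewrite mulr_sumr.
Qed.

End dot_products.

Section taps.
Context {R : realType} (Nfft Ncp L tau : nat).

Lemma jexp_conj (k : int) : jexp R Nfft k * conjc (jexp R Nfft k) = 1.
Proof.
rewrite /jexp; set t := _ / _; apply/eqP; rewrite eq_complex /=.
by rewrite mulrN opprK -!expr2 cos2Dsin2 eqxx /= mulrN mulrC addNr.
Qed.

(** Taps below [tau] lie on the plateau from 0 to [Ncp]. At [p = 0] the first branch is selected
    instead, with value [Nfft / Nfft], which is 1 as [Nfft] is positive. *)
Lemma cwt_tap (p : 'I_L) : (L <= Nfft)%N -> (tau <= Ncp + 1)%N ->
  (p < tau)%N -> cwt R Nfft Ncp p%:Z = 1.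
Proof.
move=> LN tauN ptau; have N0 : Nfft%:R != 0 :> R.
  by rewrite pnatr_eq0 -lt0n (leq_trans _ LN)// (leq_ltn_trans _ (ltn_ord p)).
rewrite /cwt; case: ifP => [/andP[_ p0]|_].
  have -> : (p : nat) = 0%N by lia.
  by rewrite addr0 divff.
by rewrite ifT//; lia.
Qed.

(* The hypotheses force [p = Ncp], where the numerator of [ctilde] vanishes; for
   [Ncp = 0] it is the first branch that applies. *)
Lemma ctilde_tap (l i : nat) (p : 'I_L) : (tau <= Ncp + 1)%N ->
  l != i -> (Ncp <= p)%N -> (p < tau)%N -> ctilde R Nfft Ncp l i p%:Z = 0.
Proof.
move=> tauN li Np ptau; have pE : (p : nat) = Ncp by lia.
have jexp0 : jexp R Nfft 0 = 1.
  by rewrite /jexp mulr0 mul0r cos0 sin0.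
rewrite /ctilde (negbTE li) pE; case: ifP => [/andP[_ N0]|_].
  have -> : Ncp = 0%N by lia.
  by rewrite mul0r jexp0 subrr mul0r.
by rewrite subrr mul0r jexp0 subrr mul0r if_same.
Qed.

End taps.

(** * Gains along a fixed realization whose Gram matrix converges *)

Section gains.
Context {R : realType} (Nfft Nsc Ncp L tau : nat) (E : 'I_L -> R).
Local Notation C := R[i].
Variable a : 'I_L -> nat -> C.
Hypothesis alpha_gt0 : 0 < alpha2 E tau.
Hypothesis gram : forall p q, ccvg
  (fun n => (n%:R^-1)%:C * \sum_(k < n) a p k * conjc (a q k))
  (if p == q then (E p)%:C else 0).

Let H n (p : 'I_L) : 'cV[C]_n := \col_(k < n) a p k.

Let dotT_lim (c d : 'I_L -> C) : ccvg
  (fun n => (n%:R^-1)%:C *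
    dotT (\sum_p c p *: H n p) (map_mx conjc (\sum_q d q *: H n q)))
  (\sum_p c p * conjc (d p) * (E p)%:C).
Proof.
have -> : \sum_p c p * conjc (d p) * (E p)%:C =
    \sum_p \sum_q c p * conjc (d q) * (if p == q then (E p)%:C else 0).
  apply: eq_bigr => p _; rewrite (bigD1 p)//= eqxx big1 ?addr0// => q qp.
  by rewrite eq_sym (negbTE qp) mulr0.
have -> : (fun n => (n%:R^-1)%:C *
      dotT (\sum_p c p *: H n p) (map_mx conjc (\sum_q d q *: H n q))) =
    fun n => \sum_p \sum_q c p * conjc (d q) *
      ((n%:R^-1)%:C * \sum_(k < n) a p k * conjc (a q k)).
  apply/funext => n; rewrite dotT_comb mulr_sumr; apply: eq_bigr => p _.
  by rewrite mulr_sumr; apply: eq_bigr => q _; rewrite mulrCA.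
by apply: ccvg_sum => p; apply: ccvg_sum => q; apply: ccvgZ.
Qed.

(** Truncation is moved into the coefficients, so that [hhat_tr] becomes a combination of all taps
    and [dotT_lim] applies. *)
Let wt (l : nat) (p : 'I_L) : C :=
  if (p < tau)%N then jexp R Nfft (- (l * p)%N%:Z) else 0.

Let hhat_trE n l : hhat_tr Nfft (H n) tau l = \sum_p wt l p *: H n p.
Proof.
rewrite /hhat_tr big_mkcond; apply: eq_bigr => p _.
by rewrite /wt; case: ifP => // _; rewrite scale0r.
Qed.

Let vnorm_lim l :
  vnorm (hhat_tr Nfft (H n) tau l) ^+ 2 / n%:R @[n --> \oo] --> alpha2 E tau.
Proof.
have [+ _] := dotT_lim (wt l) (wt l).
have -> : complex.Re (\sum_p wt l p * conjc (wt l p) * (E p)%:C) = alpha2 E tau.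
  rewrite raddf_sum /alpha2 [RHS]big_mkcond; apply: eq_bigr => p _.
  by rewrite /wt; case: ifP => _; rewrite ?jexp_conj ?mul1r ?mul0r.
under eq_fun => n.
  rewrite (_ : complex.Re _ = vnorm (hhat_tr Nfft (H n) tau l) ^+ 2 / n%:R).
    over.
  rewrite hhat_trE vnorm_sqr mulrC; case: (dotT _ _) => x y /=.
  by rewrite mulr0 subr0.
by [].
Qed.

(** With [v] the truncated channel, the normalized gain is the quotient of the squared modulus of
    [dotT] over [n] by the squared norm of [v] over [n]. Both converge, the latter to a positive
    limit. *)
Lemma gain_cvg (c : 'I_L -> C) (l : nat) :
  normc (dotT (\sum_p c p *: H n p) (precoder Nfft (H n) tau l)) ^+ 2 / n%:R
    @[n --> \oo] -->
  normc (\sum_(p < L | (p < tau)%N)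
    c p * conjc (jexp R Nfft (- (l * p)%N%:Z)) * (E p)%:C) ^+ 2 / alpha2 E tau.
Proof.
have := ccvg_normc_sqr (dotT_lim c (wt l)).
have -> : \sum_p c p * conjc (wt l p) * (E p)%:C =
    \sum_(p < L | (p < tau)%N) c p * conjc (jexp R Nfft (- (l * p)%N%:Z)) * (E p)%:C.
  rewrite [RHS]big_mkcond; apply: eq_bigr => p _.
  by rewrite /wt; case: ifP => // _; rewrite conjc0 mulr0 mul0r.
move=> num.
apply: (cvg_eq_gt0 _ (cvgM num (cvgV (lt0r_neq0 alpha_gt0) (vnorm_lim l)))).
move=> n n0 /=.
have nN0 : n%:R != 0 :> R by rewrite pnatr_eq0 -lt0n.
rewrite /precoder dotTZr !normcM !exprMn !normcR_sqr hhat_trE.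
rewrite invfM invrK !exprVn.
move: (normc _) ((vnorm _ ^+ 2)^-1) => D V; by field.
Qed.

(** Taps from [tau] on are asymptotically orthogonal to the precoder, which is built from the taps
    below [tau]. *)
Lemma gain_cvg0 (c : 'I_L -> C) (l : nat) :
  (forall p : 'I_L, (p < tau)%N -> c p = 0) ->
  normc (dotT (\sum_p c p *: H n p) (precoder Nfft (H n) tau l)) ^+ 2 / n%:R
    @[n --> \oo] --> (0 : R).
Proof.
move=> c0; have := @gain_cvg c l; rewrite big1; last first.
  by move=> p /c0 ->; rewrite !mul0r.
by rewrite normc_sqr /= expr0n addr0 mul0r.
Qed.

Hypothesis L_le_Nfft : (L <= Nfft)%N.
Hypothesis tau_le : (tau <= Ncp + 1)%N.

Let cross_coef (l i : nat) (m : 'I_L) : C :=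
  if (Ncp <= m)%N then
    ctilde R Nfft Ncp l i m%:Z * jexp R Nfft (- (l * m)%N%:Z) else 0.

Let hhat0_crossE n l i : l != i ->
  hhat0 Nfft Ncp (H n) l i = \sum_m cross_coef l i m *: H n m.
Proof.
move=> li; rewrite /hhat0 (negbTE li) big_mkcond; apply: eq_bigr => m _.
by rewrite /cross_coef; case: ifP => //; rewrite scale0r.
Qed.

Let hhatB_E n i : hhat Nfft (H n) i - hhat0 Nfft Ncp (H n) i i =
  \sum_(m < L) ((1 - (cwt R Nfft Ncp m%:Z)%:C) * jexp R Nfft (- (i * m)%N%:Z)) *: H n m.
Proof.
rewrite /hhat /hhat0 eqxx -sumrB; apply: eq_bigr => m _.
by rewrite -scalerBl mulrBl mul1r.
Qed.

Lemma cross_gain_cvg0 l i : l != i ->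
  normc (dotT (hhat0 Nfft Ncp (H n) l i) (precoder Nfft (H n) tau l)) ^+ 2 / n%:R
    @[n --> \oo] --> (0 : R).
Proof.
move=> li; under eq_fun do rewrite hhat0_crossE//.
apply: gain_cvg0 => p ptau; rewrite /cross_coef; case: ifP => // Np.
by rewrite (ctilde_tap _ tau_le)// mul0r.
Qed.

Lemma residual_gain_cvg0 i :
  normc (dotT (hhat Nfft (H n) i - hhat0 Nfft Ncp (H n) i i)
              (precoder Nfft (H n) tau i)) ^+ 2 / n%:R
    @[n --> \oo] --> (0 : R).
Proof.
under eq_fun do rewrite hhatB_E.
by apply: gain_cvg0 => p ptau; rewrite (cwt_tap L_le_Nfft tau_le)// subrr mul0r.
Qed.

Lemma previous_gain_cvg0 l i :
  normc (dotT (hhatm1 Nfft Ncp (H n) l i) (precoder Nfft (H n) tau l)) ^+ 2 / n%:R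
    @[n --> \oo] --> (0 : R).
Proof.
have jexp1 k : normc (jexp R Nfft k) ^+ 2 = 1.
  by rewrite normc_sqr_conj jexp_conj.
under eq_fun do rewrite dotTC /hhatm1 dotTZr normcM exprMn jexp1 mul1r dotTC.
(* Up to a phase and a sign, the gain from the previous block is the residual gain for [l = i] and
   the cross gain otherwise. *)
have [<-|li] := eqVneq l i.
  by under eq_fun do rewrite scale1r; exact: residual_gain_cvg0.
under eq_fun do rewrite scale0r sub0r -scaleN1r dotTC dotTZr normcM exprMn dotTC.
have -> : normc (-1 : C) ^+ 2 = 1.
  by rewrite normc_sqr /= oppr0 expr0n addr0 sqrrN expr1n.
by under eq_fun do rewrite mul1r; exact: cross_gain_cvg0.
Qed.

Lemma signal_gain_cvg i :
  normc (dotT (hhat0 Nfft Ncp (H n) i i) (precoder Nfft (H n) tau i)) ^+ 2 / n%:R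
    @[n --> \oo] --> alpha2 E tau.
Proof.
under eq_fun do rewrite /hhat0 eqxx.
have := @gain_cvg (fun m : 'I_L => (cwt R Nfft Ncp m%:Z)%:C * jexp R Nfft (- (i * m)%N%:Z)) i.
have -> : \sum_(p < L | (p < tau)%N) (cwt R Nfft Ncp p%:Z)%:C *
    jexp R Nfft (- (i * p)%N%:Z) * conjc (jexp R Nfft (- (i * p)%N%:Z)) *
    (E p)%:C = (alpha2 E tau)%:C.
  rewrite /alpha2 rmorph_sum; apply: eq_bigr => p ptau.
  by rewrite (cwt_tap L_le_Nfft tau_le)// mul1r jexp_conj mul1r.
by rewrite normcR_sqr expr2 mulfK ?gt_eqF.
Qed.

Lemma sinr_cvg (snr : nat -> R) (snr_op : R) (i : 'I_Nsc) : 0 < snr_op ->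
  (forall n, (0 < n)%N -> n%:R * snr n = snr_op) ->
  sinr Nfft Ncp (H n) tau (snr n) i @[n --> \oo] --> alpha2 E tau * snr_op.
Proof.
move=> snr0 nsnr.
(* The denominator of [sinr] divided by [n]; its noise term is constant since
   [n%:R * snr n = snr_op]. *)
pose g n := normc (dotT (precoder Nfft (H n) tau i)
  (hhat Nfft (H n) i - hhat0 Nfft Ncp (H n) i i)) ^+ 2 / n%:R +
  \sum_(l < Nsc | l != i) 2 * (normc (dotT (hhat0 Nfft Ncp (H n) l i)
    (precoder Nfft (H n) tau l)) ^+ 2 / n%:R) + snr_op^-1.
have g_cvg : g n @[n --> \oo] --> snr_op^-1.
  rewrite -[X in _ --> X]add0r; apply: cvgD; last exact: cvg_cst.
  rewrite -[X in _ --> X]addr0; apply: cvgD.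
    by under eq_fun do rewrite dotTC; exact: residual_gain_cvg0.
  have z : \sum_(l < Nsc | l != i) 2 * 0 = 0 :> R.
    by rewrite big1// => l _; rewrite mulr0.
  rewrite -[X in _ --> X]z.
  apply: cvg_sum_cond => l li.
  apply: cvgMr; apply: cross_gain_cvg0.
  by move: li; rewrite -val_eqE.
rewrite -[snr_op in X in _ --> X]invrK.
have sN0 := invr_neq0 (lt0r_neq0 snr0).
apply: (cvg_eq_gt0 _ (cvgM (signal_gain_cvg i) (cvgV sN0 g_cvg))) => n n0 /=.
have nN0 : n%:R != 0 :> R by rewrite pnatr_eq0 -lt0n.
rewrite /sinr /g -(nsnr n n0) -mulr_sumr -mulr_suml mulrA -mulr_sumr.
rewrite [in X in _ + X]invfM [_^-1 * (snr n)^-1]mulrC -!mulrDl div1r.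
by rewrite invfM invrK mulrA mulrAC mulfVK.
Qed.

End gains.

(** * Almost sure limit of the empirical Gram matrix *)

Section channel_moments.
Context {d : measure_display} {T : measurableType d} {R : realType}
  (P : probability T R) (L : nat) (E : 'I_L -> R)
  (h : 'I_L -> nat -> T -> R[i]).
Hypothesis E_ge0 : forall p, 0 <= E p.
Hypothesis h_normal : forall p k, complex_normal0 P (E p) (h p k).
Hypothesis h_indep : mutually_independent P
  (fun pk : 'I_L * nat => h pk.1 pk.2).

Let reim (pk : 'I_L * nat) (w : T) : R * R :=
  (complex.Re (h pk.1 pk.2 w), complex.Im (h pk.1 pk.2 w)).

(** A boolean selects the real or imaginary part, so that one argument covers all four products. *)
Let part (b : bool) (z : R * R) : R := if b then z.1 else z.2.

Let measurable_part b : measurable_fun setT (part b).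
Proof. by case: b; [exact: measurable_fst | exact: measurable_snd]. Qed.

Let measurable_reim pk : measurable_fun setT (reim pk).
Proof.
have [[mRe mIm] _] := h_normal pk.1 pk.2.
exact: measurable_fun_pair.
Qed.

Let measurable_part_reim b pk : measurable_fun setT (fun w => part b (reim pk w)).
Proof. exact: measurableT_comp. Qed.

Let reim_indep (s : seq ('I_L * nat)) (A : 'I_L * nat -> set (R * R)) :
  uniq s -> (forall k, measurable (A k)) ->
  P (\bigcap_(k in [set` s]) (reim k @^-1` A k)) =
  (\prod_(k <- s) P (reim k @^-1` A k))%E.
Proof. exact: h_indep. Qed.

Let part_law b pk A : measurable A ->
  P ((fun w => part b (reim pk w)) @^-1` A) = normal0_law (E pk.1 / 2) A.
Proof.
move=> mA; have [re im] := complex_normal0_marginals (h_normal pk.1 pk.2) mA.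
by case: b.
Qed.

Let part_moments b pk :
  [/\ P.-integrable setT (fun w => (part b (reim pk w) ^+ 4)%:E),
      \int[P]_w (part b (reim pk w) ^+ 4) <= 60 * (E pk.1 / 2) ^+ 2,
      \int[P]_w part b (reim pk w) = 0 &
      \int[P]_w (part b (reim pk w) ^+ 2) = E pk.1 / 2].
Proof.
by apply: normal0_law_moments => //; [rewrite divr_ge0|exact: part_law].
Qed.

Let integrable_part2 b pk :
  P.-integrable setT (fun w => (part b (reim pk w) ^+ 2)%:E).
Proof.
have [i4 _ _ _] := part_moments b pk.
exact: integrable_expr2.
Qed.

Let integrable_part b pk : P.-integrable setT (fun w => (part b (reim pk w))%:E).
Proof.
by apply: integrable_expr1 => //; exact: integrable_part2.
Qed.

(** For [j != k], [X j * X k] is a product of four independent centred variables, hence has mean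
    zero; for [j = k] it is a product of two independent squares. *)
Let slln_cross (p q : 'I_L) (b c : bool) : p != q -> {ae P, forall w,
  n%:R^-1 * (\sum_(0 <= k < n) part b (reim (p, k) w) * part c (reim (q, k) w))
    @[n --> \oo] --> (0 : R)}.
Proof.
move=> pq.
pose X k w := part b (reim (p, k) w) * part c (reim (q, k) w).
pose F (pk : 'I_L * nat) := part (if pk.1 == p then b else c).
pose F2 (pk : 'I_L * nat) z := F pk z ^+ 2.
have mF pk : measurable_fun setT (F pk) by exact: measurable_part.
have mF2 pk : measurable_fun setT (F2 pk) by exact: measurable_funX.
have iF pk : P.-integrable setT (fun w => (F pk (reim pk w))%:E).
  exact: integrable_part.
have iF2 pk : P.-integrable setT (fun w => (F2 pk (reim pk w))%:E).
  exact: integrable_part2.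
have qp : (q == p) = false by rewrite eq_sym (negbTE pq).
pose s4 (j k : nat) := [:: (p, j); (q, j); (p, k); (q, k)].
have us4 (j k : nat) : j != k -> uniq (s4 j k).
  move=> jk; rewrite /s4 /= !inE !xpair_eqE !eqxx qp (negbTE pq) (negbTE jk).
  by rewrite ?andbF ?andbT ?orbF.
have us2 (k : nat) : uniq [:: (p, k); (q, k)].
  by rewrite /= inE xpair_eqE (negbTE pq).
have X4 j k w : X j w * X k w = \prod_(pk <- s4 j k) F pk (reim pk w).
  by rewrite /s4 !big_cons big_nil /F /= eqxx qp /X; ring.
have X2 k w : X k w * X k w = \prod_(pk <- [:: (p, k); (q, k)]) F2 pk (reim pk w).
  by rewrite !big_cons big_nil /F2 /F /= eqxx qp /X; ring.
apply: (@slln_orthogonal _ _ _ P X (E p / 2 * (E q / 2))).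
- move=> j k; have [<-|jk] := eqVneq j k.
    under eq_fun do rewrite X2.
    exact: (integrable_prod measurable_reim reim_indep (us2 j) mF2 iF2).
  under eq_fun do rewrite X4.
  exact: (integrable_prod measurable_reim reim_indep (us4 _ _ jk) mF iF).
- move=> j k jk; under eq_Rintegral do rewrite X4.
  rewrite (expectation_prod measurable_reim reim_indep (us4 _ _ jk) mF iF).
  rewrite /s4 big_cons.
  have [_ _ -> _] := part_moments (if p == p then b else c) (p, j).
  by rewrite mul0r.
- move=> k; under eq_Rintegral do rewrite X2.
  rewrite (expectation_prod measurable_reim reim_indep (us2 k) mF2 iF2).
  rewrite !big_cons big_nil mulr1 /F2 /F.
  have [_ _ _ ->] := part_moments (if p == p then b else c) (p, k).
  by have [_ _ _ ->] := part_moments (if q == p then b else c) (q, k).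
Qed.

Let slln_square (p : 'I_L) (b : bool) : {ae P, forall w,
  n%:R^-1 * (\sum_(0 <= k < n) (part b (reim (p, k) w) ^+ 2 - E p / 2))
    @[n --> \oo] --> (0 : R)}.
Proof.
pose v := E p / 2.
pose X k w := part b (reim (p, k) w) ^+ 2 - v.
pose F (pk : 'I_L * nat) z := part b z ^+ 2 - v.
have mF pk : measurable_fun setT (F pk).
  by apply: measurable_funB => //; exact: measurable_funX.
have iF pk : P.-integrable setT (fun w => (F pk (reim pk w))%:E).
  exact: integrableD_EFin (integrable_part2 _ _) (integrable_cst_EFin _ _).
have us2 (j k : nat) : j != k -> uniq [:: (p, j); (p, k)].
  by move=> jk; rewrite /= inE xpair_eqE (negbTE jk) andbF.
have X2 j k w : X j w * X k w = \prod_(pk <- [:: (p, j); (p, k)]) F pk (reim pk w).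
  by rewrite !big_cons big_nil mulr1.
have X1 k w : X k w * X k w =
    part b (reim (p, k) w) ^+ 4 + ((- (2 * v)) * part b (reim (p, k) w) ^+ 2 + v ^+ 2).
  by rewrite /X; ring.
have i1 k : P.-integrable setT (fun w =>
    ((- (2 * v)) * part b (reim (p, k) w) ^+ 2 + v ^+ 2)%:E).
  exact: integrableD_EFin (integrableZl_EFin _ (integrable_part2 b (p, k)))
    (integrable_cst_EFin _ _).
(* The second moment of [X k] is the fourth moment minus [v ^+ 2], and the fourth moment is at most
   [60 * v ^+ 2]. *)
apply: (@slln_orthogonal _ _ _ P X (60 * v ^+ 2)).
- move=> j k; have [<-|jk] := eqVneq j k.
    under eq_fun do rewrite X1.
    have [i4 _ _ _] := part_moments b (p, j).
    exact: integrableD_EFin i4 (i1 j).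
  under eq_fun do rewrite X2.
  exact: (integrable_prod measurable_reim reim_indep (us2 _ _ jk) mF iF).
- move=> j k jk; under eq_Rintegral do rewrite X2.
  rewrite (expectation_prod measurable_reim reim_indep (us2 _ _ jk) mF iF).
  rewrite big_cons /F RintegralB//; last exact: integrable_cst_EFin.
    have [_ _ _ ->] := part_moments b (p, j).
    by rewrite Rintegral_cst_prob subrr mul0r.
  exact: integrable_part2.
- move=> k; under eq_Rintegral do rewrite X1.
  have [i4 b4 _ e2] := part_moments b (p, k).
  rewrite RintegralD//; last exact: i1.
  rewrite RintegralD//; [|exact/integrableZl_EFin/integrable_part2
                         |exact: integrable_cst_EFin].
  rewrite RintegralZl//; last exact: integrable_part2.
  rewrite e2 Rintegral_cst_prob /= -/v.
  move: b4; rewrite /= -/v; have := sqr_ge0 v; nra.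
Qed.

(** Real and imaginary parts of a Gram entry are a sum and a difference of two real averages. Taps
    and booleans range over finite types, so a single almost sure event serves for all of them. *)
Lemma channel_gram_cvg : {ae P, forall w, forall p q, ccvg
  (fun n => (n%:R^-1)%:C * \sum_(k < n) h p k w * conjc (h q k w))
  (if p == q then (E p)%:C else 0)}.
Proof.
pose cr p q (b c : bool) w n := n%:R^-1 *
  (\sum_(0 <= k < n) part b (reim (p, k) w) * part c (reim (q, k) w)).
pose sq p (b : bool) w n := n%:R^-1 *
  (\sum_(0 <= k < n) (part b (reim (p, k) w) ^+ 2 - E p / 2)).
have cross : {ae P, forall w, forall p q b c, p != q ->
    cr p q b c w n @[n --> \oo] --> (0 : R)}.
  apply: filter_forall => p; apply: filter_forall => q.
  apply: filter_forall => b; apply: filter_forall => c.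
  have [<-|pq] := eqVneq p q; first exact: nearW.
  by move: (slln_cross b c pq); apply: filterS.
have square : {ae P, forall w, forall p b,
    sq p b w n @[n --> \oo] --> (0 : R)}.
  by apply: filter_forall => p; apply: filter_forall => b; exact: slln_square.
move: cross square; apply: filterS2 => w cross square p q.
have square' b : cr p p b b w n @[n --> \oo] --> E p / 2.
  rewrite -[X in _ --> X]add0r.
  apply: (cvg_eq_gt0 _ (cvgD (square p b) (cvg_cst (E p / 2)))) => n n0.
  have nN0 : n%:R != 0 :> R by rewrite pnatr_eq0 -lt0n.
  rewrite /= /sq /cr sumrB sumr_const_nat subn0 -[(_ / 2) *+ n]mulr_natl.
  rewrite mulrBr mulKf// subrK.
  by congr (_ * _); apply: eq_bigr => k _; rewrite expr2.
have ReG n : complex.Re ((n%:R^-1)%:C * \sum_(k < n) h p k w * conjc (h q k w)) =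
    cr p q true true w n + cr p q false false w n.
  rewrite /cr -mulrDr -big_split/= big_mkord.
  have -> (u : R[i]) : complex.Re ((n%:R^-1)%:C * u) = n%:R^-1 * complex.Re u.
    by case: u => x y /=; rewrite mul0r subr0.
  rewrite raddf_sum; congr (_ * _); apply: eq_bigr => k _ /=.
  by case: (h p k w) => x y; case: (h q k w) => x' y' /=; rewrite mulrN opprK.
have ImG n : complex.Im ((n%:R^-1)%:C * \sum_(k < n) h p k w * conjc (h q k w)) =
    cr p q false true w n - cr p q true false w n.
  rewrite /cr -mulrBr -sumrB big_mkord.
  have -> (u : R[i]) : complex.Im ((n%:R^-1)%:C * u) = n%:R^-1 * complex.Im u.
    by case: u => x y /=; rewrite mul0r addr0.
  rewrite raddf_sum; congr (_ * _); apply: eq_bigr => k _ /=.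
  by case: (h p k w) => x y; case: (h q k w) => x' y' /=; ring.
(* On the diagonal the two averages coincide, so the imaginary part is exactly zero. *)
have crC n : cr p p false true w n = cr p p true false w n.
  by rewrite /cr; congr (_ * _); apply: eq_bigr => k _; rewrite mulrC.
split.
  under eq_fun do rewrite ReG.
  have -> : complex.Re (if p == q then (E p)%:C else 0) =
      (if p == q then E p / 2 else 0) + (if p == q then E p / 2 else 0).
    by case: ifP => _; rewrite ?addr0// -splitr.
  by apply: cvgD; case: (eqVneq p q) => [<-|pq]; by [exact: square' | exact: cross].
under eq_fun do rewrite ImG.
have -> : complex.Im (if p == q then (E p)%:C else 0) = 0 - 0.
  by rewrite subr0; case: ifP.
have [<-|pq] := eqVneq p q.
  by under eq_fun do rewrite crC subrr; rewrite subrr; exact: cvg_cst.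
by apply: cvgB; exact: cross.
Qed.

End channel_moments.

(** * Mean power of linear combinations of random symbols *)

Section mean_power.
Context {R : realType}.
Local Notation C := R[i].

(** Cauchy-Schwarz against the constant vector 1, from [2ab <= a^2 + b^2] on each cross term. *)
Lemma sqr_sum_le (N : nat) (a : 'I_N -> R) :
  (\sum_l a l) ^+ 2 <= N%:R * \sum_l a l ^+ 2.
Proof.
rewrite expr2 big_distrlr /=.
apply: (@le_trans _ _ (\sum_l \sum_j (a l ^+ 2 + a j ^+ 2) / 2)).
  apply: ler_sum => l _; apply: ler_sum => j _.
  by have := sqr_ge0 (a l - a j); nra.
rewrite (eq_bigr (fun l => (N%:R * a l ^+ 2 + \sum_j a j ^+ 2) / 2)).
  rewrite -mulr_suml big_split /= -mulr_sumr sumr_const card_ord.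
  by rewrite -[X in _ + X]mulr_natl; lra.
move=> l _; rewrite -mulr_suml big_split /= sumr_const card_ord.
by rewrite -[X in X + _]mulr_natl.
Qed.

Lemma normc_sum_sqr_le (N : nat) (z : 'I_N -> C) :
  normc (\sum_l z l) ^+ 2 <= N%:R * \sum_l normc (z l) ^+ 2.
Proof.
rewrite normc_sqr !raddf_sum (eq_bigr _ (fun l _ => normc_sqr (z l))).
by rewrite big_split /= mulrDr lerD// sqr_sum_le.
Qed.

Context {d : measure_display} {S : measurableType d} (Q : probability S R).

Lemma complex_normal0_power (v : R) (X : S -> C) : 0 <= v ->
  complex_normal0 Q v X ->
  Q.-integrable setT (fun s => (normc (X s) ^+ 2)%:E) /\
  \int[Q]_s (normc (X s) ^+ 2) = v.
Proof.
move=> v0 Xn; have [[mRe mIm] _] := Xn.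
have v20 : 0 <= v / 2 by rewrite divr_ge0.
have moments (Y : S -> R) : measurable_fun setT Y ->
    (forall A, measurable A -> Q (Y @^-1` A) = normal0_law (v / 2) A) ->
    Q.-integrable setT (fun s => (Y s ^+ 2)%:E) /\ \int[Q]_s (Y s ^+ 2) = v / 2.
  move=> mY law; have [i4 _ _ e2] := normal0_law_moments mY v20 law.
  by split => //; exact: integrable_expr2.
have [iRe eRe] := moments _ mRe
  (fun A mA => (complex_normal0_marginals Xn mA).1).
have [iIm eIm] := moments _ mIm
  (fun A mA => (complex_normal0_marginals Xn mA).2).
split.
  by under eq_fun do rewrite normc_sqr; exact: integrableD_EFin.
under eq_Rintegral do rewrite normc_sqr.
by rewrite RintegralD// eRe eIm -splitr.
Qed.

(** Pointwise Cauchy-Schwarz, then integration of each symbol power. The factor [N] is the number of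
    subcarriers, fixed as the array grows. *)
Lemma mean_power_le (N : nat) (v : R) (x : 'I_N -> S -> C) (g : 'I_N -> C) :
  0 <= v -> (forall l, complex_normal0 Q v (x l)) ->
  (mean_power Q (fun s => (\sum_l g l * x l s)%R) <=
   (N%:R * (\sum_l normc (g l) ^+ 2) * v)%:E)%E.
Proof.
move=> v0 xn.
have power l := complex_normal0_power v0 (xn l).
pose F s := N%:R * \sum_l normc (g l) ^+ 2 * normc (x l s) ^+ 2.
have isum : Q.-integrable setT
    (fun s => (\sum_l normc (g l) ^+ 2 * normc (x l s) ^+ 2)%:E).
  apply: integrable_sum_EFin => l.
  by apply: integrableZl_EFin; exact: (power l).1.
have iF : Q.-integrable setT (fun s => (F s)%:E) by exact: integrableZl_EFin.
have <- : \int[Q]_s F s = N%:R * (\sum_l normc (g l) ^+ 2) * v.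
  rewrite RintegralZl// Rintegral_sum; last first.
    by move=> l; apply: integrableZl_EFin; exact: (power l).1.
  rewrite -mulrA mulr_suml; congr (_ * _); apply: eq_bigr => l _.
  rewrite RintegralZl//; last exact: (power l).1.
  by rewrite (power l).2.
rewrite /mean_power unlock /Rintegral fineK; last exact: integrable_fin_num iF.
apply: ge0_le_integral => //.
- by move=> s _; rewrite lee_fin sqr_ge0.
- apply/measurable_EFinP.
  under eq_fun do rewrite normc_sqr !raddf_sum.
  have mx l : measurable_cplx (x l) by case: (xn l).
  apply: measurable_funD; apply: measurable_funX; apply: measurable_sum => l.
    have -> : (fun s => complex.Re (g l * x l s)) = fun s =>
        complex.Re (g l) * complex.Re (x l s) - complex.Im (g l) * complex.Im (x l s).
      by apply/funext => s; case: (g l) => ? ?; case: (x l s).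
    by apply: measurable_funB; apply: measurable_funM => //; case: (mx l).
  have -> : (fun s => complex.Im (g l * x l s)) = fun s =>
      complex.Re (g l) * complex.Im (x l s) + complex.Im (g l) * complex.Re (x l s).
    by apply/funext => s; case: (g l) => ? ?; case: (x l s).
  by apply: measurable_funD; apply: measurable_funM => //; case: (mx l).
- exact: measurable_int iF.
- move=> s _; rewrite lee_fin (le_trans (normc_sum_sqr_le _))// ler_wpM2l//.
  by apply: ler_sum => l _; rewrite normcM exprMn.
Qed.

(** Since [p n = K / n], the bound of [mean_power_le] becomes a fixed multiple of the normalized
    gains, and squeezing concludes. *)
Lemma mean_power_cvg0 (N : nat) (p : nat -> R) (K : R)
    (x : nat -> 'I_N -> S -> C) (g : nat -> 'I_N -> C) : 0 <= K ->
  (forall n, (0 < n)%N -> n%:R * p n = K) ->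
  (forall n l, (0 < n)%N -> complex_normal0 Q (p n) (x n l)) ->
  (forall l, normc (g n l) ^+ 2 / n%:R @[n --> \oo] --> (0 : R)) ->
  mean_power Q (fun s => \sum_l g n l * x n l s) @[n --> \oo] --> 0%E.
Proof.
move=> K0 npK xn g0.
have bound0 : N%:R * K * (\sum_l normc (g n l) ^+ 2 / n%:R) @[n --> \oo] --> (0 : R).
  rewrite -[X in _ --> X](mulr0 (N%:R * K)); apply: cvgMr.
  have z : \sum_(l < N) 0 = 0 :> R by rewrite big1.
  by rewrite -[X in _ --> X]z; apply: cvg_sum_cond.
apply: (@squeeze_cvge _ _ _ _ (fun=> 0%E) _
  (fun n => (N%:R * K * (\sum_l normc (g n l) ^+ 2 / n%:R))%:E)).
- exists 1%N => // n /= n0; apply/andP; split.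
    by rewrite /mean_power unlock; apply: integral_ge0 => s _; rewrite lee_fin sqr_ge0.
  have nN0 : n%:R != 0 :> R by rewrite pnatr_eq0 -lt0n.
  have pE : p n = K / n%:R by rewrite -(npK n n0) mulrAC mulfV// mul1r.
  have p0 : 0 <= p n by rewrite pE divr_ge0.
  apply: (le_trans (mean_power_le _ p0 (fun l => xn n l n0))).
  by rewrite lee_fin pE -mulr_suml le_eqVlt; apply/orP; left; apply/eqP; ring.
- exact: cvg_cst.
- by apply: cvg_EFin => //; exact: nearW.
Qed.

End mean_power.

Local Close Scope complex_scope.

(** * Limit SINR and vanishing of the interference powers *)

Theorem corollary1 (R : realType) (Nfft Nsc Ncp L tau : nat)
    (hNsc : (Nsc <= Nfft)%N) (hL1 : (1 <= L)%N) (hL : (L <= Nfft)%N)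
    (htau1 : (1 <= tau)%N) (htauL : (tau <= L)%N)
    (* channel *)
    (dT : measure_display) (T : measurableType dT) (P : probability T R)
    (E : 'I_L -> R) (hE : forall p, 0 <= E p) (halpha : 0 < alpha2 E tau)
    (h : 'I_L -> nat -> T -> R[i])
    (h_normal : forall p k, complex_normal0 P (E p) (h p k))
    (h_indep : mutually_independent P
                 (fun pk : 'I_L * nat => h pk.1 pk.2))
    (* noise variance and transmit power, the latter depending on the number
       n of antennas so that n * SNR = SNR_op is fixed *)
    (snr_op sigma2 : R) (hsnr_op : 0 < snr_op) (hsigma2 : 0 < sigma2)
    (Ptx : nat -> R)
    (hPtx : forall n, (0 < n)%N -> n%:R * (Ptx n / sigma2) = snr_op)
    (* data symbols *)
    (dS : measure_display) (S : measurableType dS) (Q : probability S R)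
    (x : nat -> int -> 'I_Nsc -> S -> R[i])
    (x_normal : forall n b l, (0 < n)%N -> complex_normal0 Q (Ptx n) (x n b l))
    (x_indep : forall n, (0 < n)%N -> mutually_independent Q
                 (fun bl : int * 'I_Nsc => x n bl.1 bl.2))
    (i : 'I_Nsc) (htau : (tau <= Ncp + 1)%N) :
  [/\ sinr_inf Nfft Ncp E tau snr_op i = alpha2 E tau * snr_op,
      {ae P, forall w,
        sinr Nfft Ncp (channel h w n) tau (Ptx n / sigma2) i @[n --> \oo]
          --> sinr_inf Nfft Ncp E tau snr_op i},
      {ae P, forall w,
        mean_power Q (fun s =>
          ici Nfft Ncp (channel h w n) tau (fun b l => x n b l s) i)
          @[n --> \oo] --> 0%E}
    & {ae P, forall w,
        mean_power Q (fun s =>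
          isi Nfft Ncp (channel h w n) tau (fun b l => x n b l s) i)
          @[n --> \oo] --> 0%E}].
Proof.
have sinr_infE : sinr_inf Nfft Ncp E tau snr_op i = alpha2 E tau * snr_op.
  rewrite /sinr_inf [X in X ^+ 2](_ : _ = alpha2 E tau); last first.
    by apply: eq_bigr => p ptau; rewrite (cwt_tap hL htau)// mul1r.
  rewrite [X in X + _]big1 ?add0r => [|l _].
    by rewrite expr2 invfM invrK mulrA mulfK// gt_eqF.
  (* The hypothesis [tau <= Ncp + 1] leaves no index with [Ncp < p < tau], so the interference sum
     is empty. *)
  rewrite big_pred0 ?normc_sqr /= ?expr0n ?addr0 ?mulr0// => p.
  by apply/negbTE/negP => /andP[]; move: htau; lia.
have gram := channel_gram_cvg hE h_normal h_indep.
have K0 : 0 <= snr_op * sigma2 by rewrite mulr_ge0// ltW.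
have nPtx n : (0 < n)%N -> n%:R * Ptx n = snr_op * sigma2.
  by move=> /hPtx <-; rewrite mulrA mulfVK// gt_eqF.
split => //.
- move: gram; apply: filterS => w gram; rewrite sinr_infE.
  exact: (sinr_cvg (a := fun p k => h p k w) halpha gram hL htau i hsnr_op hPtx).
- move: gram; apply: filterS => w gram.
  (* Extending the gains by 0 at [l = i] turns the ICI into a sum over all subcarriers, as
     [mean_power_cvg0] expects. *)
  pose g n (l : 'I_Nsc) := if (l : nat) != i then
    dotT (hhat0 Nfft Ncp (channel h w n) l i)
         (precoder Nfft (channel h w n) tau l) else 0.
  have -> : (fun n => mean_power Q (fun s =>
        ici Nfft Ncp (channel h w n) tau (fun b l => x n b l s) i)) =
      fun n => mean_power Q (fun s => \sum_l g n l * x n 0 l s).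
    apply/funext => n; congr mean_power; apply/funext => s.
    rewrite /ici big_mkcond; apply: eq_bigr => l _.
    by rewrite /g -val_eqE; case: ifP => // _; rewrite mul0r.
  apply: (mean_power_cvg0 K0 nPtx) => [n l n0|l]; first exact: x_normal.
  have [li|li] := boolP ((l : nat) != i).
    under eq_fun do rewrite /g li.
    exact: (cross_gain_cvg0 Nfft (a := fun p k => h p k w) halpha gram htau li).
  under eq_fun do rewrite /g (negbTE li) normc_sqr /= expr0n addr0 mul0r.
  exact: cvg_cst.
- move: gram; apply: filterS => w gram.
  apply: (mean_power_cvg0 K0 nPtx) => [n l n0|l]; first exact: x_normal.
  exact: (previous_gain_cvg0 (a := fun p k => h p k w) halpha gram hL htau).
Qed.
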